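(* Let $\widetilde{G}$ be a connected mixed graph. Then $n^{-}(\widetilde{G})= m(\widetilde{G})+c(\widetilde{G})$ if and only if $\widetilde{G}$ satisfies both of the conditions (i) and (ii) and either one of the conditions (iii) and (iv) below: (i) any two cycles of $\widetilde{G}$ share no common vertices; (ii) for each cycle $\widetilde{C_{q}}$ of $\widetilde{G}$ (with $q$ vertices), $q$ is odd, $\sigma(\widetilde{C_{q}})$ is even and $|\sigma(\widetilde{C_{q}})-q| \equiv 3 \pmod 4$; (iii) there exists a maximum matching $M(\widetilde{G})$ of $\widetilde{G}$ such that $M(\widetilde{G}) \cap \mathscr{F}(\widetilde{G}) =\emptyset$; (iv) $m(T_{\widetilde{G}})=m([T_{\widetilde{G}}])$.
   Context: All graphs are finite, without loops or multiple edges. A mixed graph $\widetilde{G}$ is obtained from an undirected graph $G$ (its underlying graph) by orienting some of the edges of $G$; cycles, matchings and connectedness of $\widetilde{G}$ refer to $G$. If $\widetilde{G}$ has vertices $v_1,\dots,v_n$, its Hermitian adjacency matrix is the $n\times n$ matrix $H(\widetilde{G})=(h_{kl})$ with $h_{kl}=-h_{lk}=\mathbf{i}$ (the imaginary unit) if there is an arc from $v_k$ to $v_l$, $h_{kl}=h_{lk}=1$ if $v_k,v_l$ are joined by an undirected edge, and $h_{kl}=0$ otherwise. $H(\widetilde{G})$ is Hermitian; $n^{-}(\widetilde{G})$ denotes the number of negative eigenvalues of $H(\widetilde{G})$ (with multiplicity). The matching number $m(\cdot)$ is the maximum cardinality of a matching of the underlying graph; a maximum matching is a matching of that cardinality. $c(\widetilde{G})=|E(G)|-|V(G)|+\omega(G)$,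 where $\omega(G)$ is the number of connected components of $G$. The signature of a mixed cycle $\widetilde{C}$ is $\sigma(\widetilde{C})=|f-b|$, where $f$ and $b$ are the numbers of forward-oriented and backward-oriented arcs of $\widetilde{C}$ with respect to a traversal of the cycle (undirected edges are not counted). When any two distinct cycles of $\widetilde{G}$ are vertex disjoint: $T_{\widetilde{G}}$ denotes the forest obtained by contracting each cycle of $\widetilde{G}$ into a vertex (called a cyclic vertex); $[T_{\widetilde{G}}]$ denotes the subgraph of $T_{\widetilde{G}}$ induced by all non-cyclic vertices (an empty graph has matching number $0$); and $\mathscr{F}(\widetilde{G})$ denotes the set of edges of $\widetilde{G}$ that have one endpoint on a cycle and the other endpoint outside that cycle. *)

(* Defs.v *)
From mathcomp Require Import all_boot all_order all_algebra.

Set Implicit Arguments.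
Unset Strict Implicit.
Unset Printing Implicit Defensive.

Import Order.TTheory GRing.Theory Num.Theory.

Record sgraph (V : finType) := SGraph {
  adj : rel V;
  adj_sym : symmetric adj;
  adj_irr : irreflexive adj
}.

Section SimpleGraphs.
Variables (V : finType) (G : sgraph V).

Definition edges : {set {set V}} :=
  [set [set p.1; p.2] | p : V * V & adj G p.1 p.2].

Definition connected : Prop :=
  0 < #|V| /\ forall x y : V, connect (adj G) x y.

Definition num_components : nat := n_comp (adj G) V.

Definition cyclomatic : int :=
  (#|edges|%:Z - #|V|%:Z + num_components%:Z)%R.

Definition is_matching (M : {set {set V}}) : bool :=
  (M \subset edges) && trivIset M.

Definition matching_number : nat := \max_(M | is_matching M) #|M|.

Definition is_max_matching (M : {set {set V}}) : bool :=
  is_matching M && (#|M| == matching_number).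

(* A cycle is given by a traversal, i.e. the list of its vertices in cyclic
   order. Rotations and reversals of the list traverse the same cycle, so the
   cycle as a subgraph is identified by its edge set [cycle_edges c]. *)
Definition is_cycle (c : seq V) : bool :=
  [&& 2 < size c, uniq c & cycle (adj G) c].

Definition cycle_edges (c : seq V) : {set {set V}} :=
  [set [set x; next c x] | x in c].

Definition disjoint_cycles : Prop :=
  forall c1 c2 : seq V, is_cycle c1 -> is_cycle c2 ->
    cycle_edges c1 != cycle_edges c2 -> [disjoint c1 & c2].

(* The vertex sets of the cycles. *)
Definition cycle_sets : {set {set V}} :=
  [set C : {set V} | [exists t : #|C|.-tuple V,
                        is_cycle t && (C == [set x in t])]].

(* An edge e leaves the cycle on C when exactly one end of e lies in C. *)
Definition cycle_boundary_edges : {set {set V}} :=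
  [set e in edges | [exists C in cycle_sets, #|e :&: C| == 1]].

(* Vertices of the contracted graph: one per cycle (its vertex set), and the
   singletons of the vertices lying on no cycle. This is a partition of V, and
   the simple graph below is the contraction, when [disjoint_cycles] holds;
   no two edges then become parallel, since they would create a cycle meeting
   the contracted ones. *)
Definition contraction_blocks : {set {set V}} :=
  cycle_sets :|: [set [set x] | x in ~: cover cycle_sets].

Definition block : finType := {B : {set V} | B \in contraction_blocks}.

Definition contracted_adj : rel block := fun B B' =>
  (B != B') && [exists x in val B, exists y in val B', adj G x y].

Lemma contracted_adj_sym : symmetric contracted_adj.
Proof.
suff imp B B' : contracted_adj B B' -> contracted_adj B' B.
  by move=> B B'; apply/idP/idP; apply: imp.
case/andP=> neq /exists_inP[x xB] /exists_inP[y yB' xy].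
rewrite /contracted_adj eq_sym neq; apply/exists_inP; exists y => //.
by apply/exists_inP; exists x; rewrite // adj_sym.
Qed.

Lemma contracted_adj_irr : irreflexive contracted_adj.
Proof. by move=> B; rewrite /contracted_adj eqxx. Qed.

Definition contracted : sgraph block :=
  SGraph contracted_adj_sym contracted_adj_irr.

Definition noncyclic_blocks : {set block} :=
  [set B : block | val B \notin cycle_sets].

Section Induced.
Variable S : {set V}.

Definition induced_adj : rel {x : V | x \in S} :=
  fun x y => adj G (val x) (val y).

Lemma induced_adj_sym : symmetric induced_adj.
Proof. by move=> x y; apply: adj_sym. Qed.

Lemma induced_adj_irr : irreflexive induced_adj.
Proof. by move=> x; apply: adj_irr. Qed.

Definition induced : sgraph {x : V | x \in S} :=
  SGraph induced_adj_sym induced_adj_irr.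

End Induced.

End SimpleGraphs.

Definition contracted_noncyclic (V : finType) (G : sgraph V) :=
  induced (contracted G) (noncyclic_blocks G).

(* [arc x y]: the edge {x, y} is oriented from x to y. *)
Record mixed_graph (V : finType) := MixedGraph {
  underlying :> sgraph V;
  arc : rel V;
  arc_adj : forall x y, arc x y -> adj underlying x y;
  arc_asym : forall x y, arc x y -> ~~ arc y x
}.

Section MixedGraphs.
Variables (V : finType) (G : mixed_graph V).

Definition forward_arcs (c : seq V) : nat :=
  count (fun x => arc G x (next c x)) c.

Definition backward_arcs (c : seq V) : nat :=
  count (fun x => arc G (next c x) x) c.

Definition signature (c : seq V) : nat :=
  `|forward_arcs c - backward_arcs c|.

Local Open Scope ring_scope.

(* [C] plays the role of the field of complex numbers. *)
Variable C : numClosedFieldType.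

Definition hermitian_entry (x y : V) : C :=
  if arc G x y then 'i
  else if arc G y x then - 'i
  else if adj G x y then 1
  else 0.

Definition hermitian_adjacency : 'M[C]_#|V| :=
  \matrix_(k, l) hermitian_entry (enum_val k) (enum_val l).

End MixedGraphs.

(* The roots of the characteristic polynomial, with multiplicity. *)
Definition eigenvalues (C : numClosedFieldType) (n : nat) (A : 'M[C]_n) :
    seq C :=
  sval (closed_field_poly_normal (char_poly A)).

Definition num_neg_eigenvalues (C : numClosedFieldType) (V : finType)
    (G : mixed_graph V) : nat :=
  count (fun a : C => (a < 0)%R) (eigenvalues (hermitian_adjacency G C)).

(* Main.v *)
(* Let c(S), m(S) and n(S) be the cycle rank, the matching number and the negative
   inertia of the subgraph induced on S.  Deleting a vertex x of a cycle lowers c by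
   at least one, n by at most one and does not increase m; a forest has a vertex cover
   of m vertices (Koenig), outside which the Hermitian form vanishes, so n <= m there,
   and n <= m + c in general.

   If equality holds, every such deletion must lower c by exactly one, which forces the
   cycles to be disjoint, and must preserve m, so that the vertices of cycles are missed
   by some maximum matching.  Two ends of a bridge cannot both be missed by maximum
   matchings; walking around a cycle from a missed vertex and shifting the matching,
   one finds that the cycle is odd and that the matching never leaves it.

   Conversely, let the cycles be disjoint and odd.  Koenig's theorem in the contracted
   forest, together with (iii) or (iv), provides a set A of vertices off the cycles that
   covers all edges not on a cycle and is matched outside the cycles to a set B.  Removing
   pendant pairs of the forest on A and B one by one gives n = |A| + sum_K n(K) over the
   cycles K, while m = |A| + sum_K (|K| - 1) / 2 and c is the number of cycles.  Finally
   n(K) <= (|K| + 1) / 2, with equality iff the form is negative at the vector orthogonal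
   to all basis vectors of K but one, and this is the congruence of (ii). *)
From mathcomp Require Import all_boot all_order all_algebra.
From mathcomp Require Import zify ring.
Require Import Defs.

Set Implicit Arguments.
Unset Strict Implicit.
Unset Printing Implicit Defensive.

(** * Components and cycle rank of induced subgraphs *)

Section InducedSubgraphs.
Variables (V : finType) (G : sgraph V).
Implicit Types (S T : {set V}) (x y z : V).

(** Induced subgraphs are subsets of one fixed vertex type, and their Hermitian matrices are the
    full matrix with all other rows and columns set to zero, so that deleting a vertex changes
    neither the type nor the size. The invariants are compared through 2n, 2m and 2c, because
    matchings are counted by their matched vertices. Deleting vertices yields (i), the oddness of
    the cycles and (iii), but says nothing about orientations. The congruence of (ii) is therefore
    obtained by feeding these three facts into the formulas of the converse: m + c is |A| plus the
    sum of (|K| + 1) / 2, so equality splits into one equality for each cycle. The residue 3 comes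
    from the product of the entries along a cycle, which is i^(f - b). For q = 2k + 1 the form at
    the distinguished vector is twice the real part of (-1)^k i^(f - b); it is negative exactly if f
    - b is even and k + (f - b) / 2 is odd, that is, if q - |f - b| is 3 modulo 4. *)

Definition sub_adj S : rel V := fun x y => [&& x \in S, y \in S & adj G x y].

Definition nbrs S x : {set V} := [set y in S | adj G x y].

Definition component S x : {set V} := [set y in S | connect (sub_adj S) x y].

Definition components S : {set {set V}} := [set component S x | x in S].

Definition nbr_components S x : {set {set V}} :=
  [set component (S :\ x) y | y in nbrs S x].

Lemma sub_adj_sym S : symmetric (sub_adj S).
Proof. by move=> x y; rewrite /sub_adj adj_sym; case: (x \in S); case: (y \in S). Qed.

Lemma sub_adjC S x y : connect (sub_adj S) x y = connect (sub_adj S) y x.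
Proof. exact: (sym_connect_sym (@sub_adj_sym S)). Qed.

Lemma sub_adjS S T : S \subset T -> subrel (connect (sub_adj S)) (connect (sub_adj T)).
Proof.
move=> /subsetP ST; apply: connect_sub => x y /and3P[xS yS xy].
by apply: connect1; rewrite /sub_adj !ST.
Qed.

(** Replaces induction on paths. Adjacency being symmetric, closure in one direction is enough. *)
Lemma connect_stable S (a : pred V) x y :
  (forall z t, sub_adj S z t -> a z -> a t) -> connect (sub_adj S) x y -> a x -> a y.
Proof.
move=> cl; have cl' : closed (sub_adj S) a.
  by apply: intro_closed => [|z t zt]; [exact: (sym_connect_sym (@sub_adj_sym S)) | exact: cl zt].
by move=> /(closed_connect cl'); rewrite -!topredE /= => ->.
Qed.

Lemma connect_in S x y : connect (sub_adj S) x y -> x \in S -> y \in S.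
Proof. by move=> xy; apply: (@connect_stable S (fun z => z \in S)) xy => z t /and3P[]. Qed.

Lemma component_self S x : x \in S -> x \in component S x.
Proof. by move=> xS; rewrite inE xS connect0. Qed.

Lemma component_eq S x y : x \in S -> y \in S ->
  (component S x == component S y) = connect (sub_adj S) x y.
Proof.
move=> xS yS; apply/eqP/idP => [/setP/(_ y)|xy]; first by rewrite !inE yS connect0.
apply/setP => z; rewrite !inE; congr (_ && _).
by apply: (same_connect (sym_connect_sym (@sub_adj_sym S))).
Qed.

Lemma nbrsP S x y : x \in S -> y \in nbrs S x -> [/\ y \in S :\ x, y \in S & adj G x y].
Proof.
move=> xS; rewrite !inE => /andP[yS xy]; rewrite yS xy andbT; split=> //.
by apply: contraTneq xy => ->; rewrite adj_irr.
Qed.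

Lemma connect_delete S x y z : y \in S :\ x -> ~~ connect (sub_adj S) x y ->
  connect (sub_adj S) y z = connect (sub_adj (S :\ x)) y z.
Proof.
move=> yT nxy; apply/idP/idP; last exact: (sub_adjS (subsetDl _ _)). move=> yz.
apply: (connect_stable _ yz (connect0 _ _)) => {yz}z t zt yz.
have zT := connect_in yz yT; case/and3P: (zt) => zS tS azt.
apply: (connect_trans (yz) (connect1 _)); rewrite /sub_adj zT azt andbT !inE tS andbT.
apply: contraNneq nxy => tx; rewrite sub_adjC -tx.
by apply: connect_trans (connect1 zt); apply: sub_adjS yz; exact: subsetDl.
Qed.

(** Cut a path at its last visit to [x]; the next vertex is [w]. Instead of cutting a path, the
    proof checks that the vertices reached in this way, together with [x], are closed under
    adjacency. *)
Lemma connect_nbr S x y : x \in S -> y \in S :\ x -> connect (sub_adj S) x y ->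
  exists2 w, w \in nbrs S x & connect (sub_adj (S :\ x)) w y.
Proof.
move=> xS yT xy;
pose a := [pred z | (z == x) || [exists w in nbrs S x, connect (sub_adj (S :\ x)) w z]].
have : a y.
  apply: (@connect_stable S a x y) => //=; last by rewrite eqxx.
  move=> z t /and3P[zS tS zt] /predU1P[zx|/exists_inP[w wN wz]]; apply/orP.
    right; apply/exists_inP; exists t; rewrite ?connect0 // !inE tS -zx //.
  have [tx|tx] := eqVneq t x; first by left.
  right; apply/exists_inP; exists w => //; apply: (connect_trans (wz) (connect1 _)).
  have [wT _ _] := nbrsP xS wN.
  by rewrite /sub_adj (connect_in wz wT) zt !inE tx tS.
by rewrite /= => /predU1P[yx|/exists_inP//]; move: yT; rewrite yx !inE eqxx.
Qed.

Lemma component_delete S x y : y \in S :\ x -> ~~ connect (sub_adj S) x y ->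
  component (S :\ x) y = component S y.
Proof.
move=> yT xy; apply/setP => z; rewrite !inE -(connect_delete _ yT xy).
by case: eqVneq => //= ->; rewrite sub_adjC (negPf xy) andbF.
Qed.

(** The component of [x] is replaced by the components containing its neighbours (none if [x] is
    isolated); the other components, collected in [F], are unchanged. *)
Lemma card_components_delete S x : x \in S ->
  #|components (S :\ x)| + 1 = #|components S| + #|nbr_components S x|.
Proof.
move=> xS; pose F := [set component S y | y in S & ~~ connect (sub_adj S) x y].
have E1 : components S = component S x |: F.
  apply/setP => B; rewrite in_setU1; apply/imsetP/predU1P.
    case=> y yS ->; have [xy|xy] := boolP (connect (sub_adj S) x y).
      by left; apply/eqP; rewrite component_eq // sub_adjC.
    by right; apply/imsetP; exists y; rewrite ?inE ?yS.
  case=> [->|/imsetP[y]]; first by exists x.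
  by rewrite !inE => /andP[yS _] ->; exists y.
have xF : component S x \notin F.
  apply/imsetP => -[y]; rewrite !inE => /andP[yS /negP nxy] /eqP.
  by rewrite component_eq.
have E2 : components (S :\ x) = nbr_components S x :|: F.
  apply/setP => B; rewrite in_setU; apply/imsetP/orP.
    case=> y yT ->; have [xy|xy] := boolP (connect (sub_adj S) x y).
      left; have [w wN wy] := connect_nbr xS yT xy; apply/imsetP; exists w => //.
      by apply/eqP; rewrite component_eq // 1?sub_adjC //; case/(nbrsP xS): wN.
    right; apply/imsetP; exists y.
      by move: yT; rewrite !inE xy andbT => /andP[].
    exact: component_delete.
  case=> /imsetP[y]; first by move=> /(nbrsP xS)[yT _ _] ->; exists y.
  rewrite !inE => /andP[yS xy] ->.
  have yT : y \in S :\ x.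
    by rewrite !inE yS andbT; apply: contraNneq xy => ->; apply: connect0.
  exists y => //; exact/esym/component_delete.
have dF : [disjoint nbr_components S x & F].
  apply/pred0P => B /=; apply/negbTE/negP => /andP[/imsetP[w wN ->] /imsetP[y]].
  rewrite !inE => /andP[yS /negP nxy] /setP/(_ w).
  have [wT wS xw] := nbrsP xS wN.
  rewrite component_self // inE wS /= => /esym yw; apply: nxy.
  rewrite sub_adjC; apply: connect_trans yw _; rewrite sub_adjC; apply: connect1.
  by rewrite /sub_adj xS wS.
rewrite E1 E2 cardsU1 xF cardsU disjoint_setI0 // cards0; lia.
Qed.

Definition degree_sum S : nat := \sum_(x in S) #|nbrs S x|.

Lemma degree_sum_delete S x : x \in S ->
  degree_sum S = degree_sum (S :\ x) + 2 * #|nbrs S x|.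
Proof.
move=> xS; rewrite /degree_sum (big_setD1 x) //=.
have -> : \sum_(y in S :\ x) #|nbrs S y|
   = \sum_(y in S :\ x) (#|nbrs (S :\ x) y| + adj G x y).
  apply: eq_bigr => y yT; rewrite (cardsD1 x) [_ + #|_|]addnC; congr (_ + _).
    by apply: eq_card => z; rewrite !inE andbA.
  by rewrite inE xS adj_sym.
rewrite big_split /= mulSn mul1n addnCA; congr (_ + (_ + _)).
rewrite -sum1_card big_mkcond [RHS]big_mkcond /=; apply: eq_bigr => y _.
rewrite !inE; case: (eqVneq y x) => [->|_] /=; first by rewrite adj_irr andbF.
by case: (y \in S) => //=; case: (adj _ _ _).
Qed.

Lemma nbr_components_le S x : #|nbr_components S x| <= #|nbrs S x|.
Proof. exact: leq_imset_card. Qed.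

(** The drop of the cycle rank when [x] is deleted: into each component of [S :\ x] that touches
    [x], one edge closes no cycle and every further one does. *)
Definition excess S x := #|nbrs S x| - #|nbr_components S x|.

(* The halving and the subtraction are exact: see [cycle_rankE]. *)
Definition cycle_rank S : nat := (degree_sum S)./2 + #|components S| - #|S|.

(** Exhibiting some [k] settles at once that the degree sum is even and that the truncated
    subtraction loses nothing. Each vertex put back increases [k] by its excess. *)
Lemma cycle_rankE S :
  degree_sum S + 2 * #|components S| = 2 * #|S| + 2 * cycle_rank S.
Proof.
suff [k kE] : exists k, degree_sum S + 2 * #|components S| = 2 * #|S| + 2 * k.
  rewrite /cycle_rank; lia.
have [n] := ubnP #|S|; elim: n S => // n IH S.
have [->|[x xS]] := set_0Vmem S.
  move=> _; exists 0; rewrite /degree_sum big_set0 cards0.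
  by rewrite /components imset0 cards0.
rewrite (cardsD1 x) xS ltnS => /IH[k kE].
exists (k + excess S x); rewrite /excess.
have := degree_sum_delete xS; have := card_components_delete xS.
have := nbr_components_le S x; lia.
Qed.

Lemma cycle_rank_delete S x : x \in S ->
  cycle_rank S = cycle_rank (S :\ x) + excess S x.
Proof.
move=> xS; have := cycle_rankE S; have := cycle_rankE (S :\ x).
have := degree_sum_delete xS; have := card_components_delete xS.
have := nbr_components_le S x; rewrite /excess (cardsD1 x S) xS; lia.
Qed.

Lemma cycle_rank0 : cycle_rank set0 = 0.
Proof.
by rewrite /cycle_rank /degree_sum big_set0 /components imset0 !cards0.
Qed.

Lemma cycle_rankS S T : S \subset T -> cycle_rank S <= cycle_rank T.
Proof.
move=> ST; have [n] := ubnP #|T :\: S|; elim: n T ST => // n IH T ST.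
have [/eqP|[x]] := set_0Vmem (T :\: S).
  by rewrite setD_eq0 => TS _; have -> // : S = T by apply/eqP; rewrite eqEsubset ST.
move=> xTS; case/setDP: (xTS) => xT xS; rewrite (cardsD1 x) xTS ltnS => le.
rewrite (cycle_rank_delete xT); apply: leq_trans (leq_addr _ _); apply: IH.
  by rewrite subsetD1 ST.
suff -> : T :\ x :\: S = (T :\: S) :\ x by [].
by apply/setP => z; rewrite !inE andbCA.
Qed.

(** Pigeonhole: the excess is positive iff the map from neighbours of [x] to their components is not
    injective. *)
Lemma excess_gt0P S x : x \in S -> reflect
  (exists y z, [/\ y \in nbrs S x, z \in nbrs S x, y != z
                 & connect (sub_adj (S :\ x)) y z]) (0 < excess S x).
Proof.
move=> xS; rewrite subn_gt0 ltnNge; apply: (iffP idP); last first.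
  case=> y [z [yN zN yz cyz]]; apply/negP => le.
  have /imset_injP inj : #|nbr_components S x| == #|nbrs S x|.
    by rewrite eqn_leq nbr_components_le.
  move/eqP: yz; apply; apply: inj => //; apply/eqP.
  by rewrite component_eq //; [case/(nbrsP xS): yN | case/(nbrsP xS): zN].
move=> lt; have /dinjectivePn[y yN [z]] : ~~ dinjectiveb (component (S :\ x)) (nbrs S x).
  by apply: contraL lt => /dinjectiveP inj;
    rewrite /nbr_components (card_in_imset inj) negbK leqnn.
move=> /predD1P[/eqP zy zN] yz; exists y, z; split; rewrite // 1?eq_sym //.
rewrite -component_eq ?yz //; first by case/(nbrsP xS): yN.
by case/(nbrsP xS): zN.
Qed.

(** * Cycles and the excess at their vertices *)

Lemma cycle_setsP (C : {set V}) :
  reflect (exists2 c, is_cycle G c & C = [set x in c]) (C \in cycle_sets G).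
Proof.
apply: (iffP idP); rewrite inE.
  by move=> /existsP[t /andP[ct /eqP Ct]]; exists t.
case=> c cc Cc; have sc : size c == #|C|.
  by rewrite Cc cardsE; case/and3P: cc => _ /card_uniqP ->.
by apply/existsP; exists (Tuple sc); rewrite cc; apply/eqP.
Qed.

Lemma is_cycle_rot i c : is_cycle G (rot i c) = is_cycle G c.
Proof. by rewrite /is_cycle size_rot rot_uniq rot_cycle. Qed.

Lemma prev_head x s : uniq (x :: s) -> prev (x :: s) x = last x s.
Proof.
move=> us; have nl : next (x :: s) (last x s) = x.
  by rewrite next_nth mem_last index_last // nth_default.
by rewrite -[RHS](prev_next us) nl.
Qed.

Lemma path_connect S x p : path (adj G) x p -> {subset x :: p <= S} ->
  connect (sub_adj S) x (last x p).
Proof.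
elim: p x => [|y p IH] x /=; first by rewrite connect0.
case/andP=> xy yp sub; apply: (connect_trans _ (IH y yp _)).
  by apply: connect1; rewrite /sub_adj xy !sub ?inE ?eqxx ?orbT.
by move=> z zp; apply: sub; rewrite inE zp orbT.
Qed.

(** Once the list is rotated to start at [x], its tail is a path from the successor to the
    predecessor of [x] that avoids [x]. Hence a vertex of a cycle has positive excess. *)
Lemma cycle_nbrs c S x : is_cycle G c -> {subset c <= S} -> x \in c ->
  [/\ next c x \in nbrs S x, prev c x \in nbrs S x, next c x != prev c x
     & connect (sub_adj (S :\ x)) (next c x) (prev c x)].
Proof.
move=> cc cS xc; have /and3P[_ uc cyc] := cc.
have nS : next c x \in nbrs S x by rewrite inE cS ?mem_next //= next_cycle.
have pS : prev c x \in nbrs S x by rewrite inE cS ?mem_prev //= adj_sym prev_cycle.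
have [i p ip] := rot_to xc.
have := is_cycle_rot i c; rewrite ip cc => /and3P[sz up cp].
rewrite nS pS -(next_rot i uc) -(prev_rot i uc) ip (prev_head up).
case: p sz up cp ip => [//|y [//|z p]] _ up cp ip.
have -> : next [:: x, y, z & p] x = y by rewrite /= eqxx.
split=> //.
  by case/and3P: up => _ ny _; apply: contraNneq ny => {1}->; exact: (mem_last z p).
apply: (@path_connect _ y (z :: p)).
  by move: cp; rewrite (cycle_path x) /= => /and4P[_ _ -> ->].
move=> t tp; rewrite in_setD1 cS; last by rewrite -(mem_rot i) ip inE tp orbT.
by rewrite andbT; case/andP: up => nx _; apply: contraNneq nx => <-.
Qed.

(** Converse of [cycle_nbrs]: a shortened path between two neighbours of [x] closes up through [x].
    Its two edges at [x] are recorded because cycles are compared by their edges. *)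
Lemma cycle_through S x y z : x \in S -> y \in nbrs S x -> z \in nbrs S x ->
  y != z -> connect (sub_adj (S :\ x)) y z ->
  exists c, [/\ is_cycle G c, {subset c <= S}, x \in c, next c x = y & prev c x = z].
Proof.
move=> xS yN zN yz /connectP[p0 path0 zE]; move: zN yz; rewrite {z}zE.
have [yT yS xy] := nbrsP xS yN.
case/shortenP: path0 => p yp up _ zN yz.
have [zT zS xz] := nbrsP xS zN.
have sub : {subset y :: p <= S :\ x}.
  elim: p y {up yN yz zN xy xz yS zT zS} yT yp => [|w p IH] y yT /=.
    by move=> _ t; rewrite inE => /eqP ->.
  case/andP=> /and3P[_ wT _] wp t; rewrite inE => /predU1P[-> //|].
  exact: IH.
have ux : uniq (x :: y :: p).
  by rewrite cons_uniq up andbT; apply/negP => /sub; rewrite !inE eqxx.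
exists (x :: y :: p); split; rewrite ?mem_head //; last by rewrite prev_head.
- rewrite /is_cycle ux; case: p yp up zN yz zT zS xz sub ux => [|w p] yp up zN yz zT zS xz sub ux.
    by rewrite eqxx in yz.
  rewrite (cycle_path x) [last _ _]/= [path _ _ _]/= adj_sym xz xy /=.
  by move: yp => /= /andP[/and3P[_ _ ->]] /=; apply: sub_path => ? ? /and3P[].
- move=> t; rewrite inE => /predU1P[-> //|/sub]; by rewrite inE => /andP[].
- by rewrite /= eqxx.
Qed.

Lemma mem_cycle_edges c x w : is_cycle G c -> [set x; w] \in cycle_edges c ->
  x \in c /\ (w = next c x \/ w = prev c x).
Proof.
case/and3P=> _ uc cyc /imsetP[u uc' E].
have un : u != next c u by apply: contraTneq (next_cycle cyc uc') => <-; rewrite adj_irr.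
have xw : x != w.
  apply: contraNneq un => xw; move/setP: E => E.
  have := E u; have := E (next c u); rewrite xw !inE !eqxx orbT !orbb /=.
  by move=> /eqP -> /eqP ->.
have : x \in [set u; next c u] by rewrite -E !inE eqxx.
have : w \in [set u; next c u] by rewrite -E !inE eqxx orbT.
rewrite !inE => /orP[]/eqP wE /orP[]/eqP xE; rewrite ?mem_next; subst.
- by rewrite eqxx in xw.
- by rewrite mem_next prev_next //; split=> //; right.
- by split=> //; left.
- by rewrite eqxx in xw.
Qed.

Lemma cycle_edge_next c x : x \in c -> [set x; next c x] \in cycle_edges c.
Proof. exact: imset_f. Qed.

Lemma cycle_edge_prev c x : is_cycle G c -> x \in c -> [set x; prev c x] \in cycle_edges c.
Proof.
case/and3P=> _ uc _ xc; rewrite setUC -{2}(next_prev uc x); apply: imset_f.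
by rewrite mem_prev.
Qed.

(** With two different pairs of neighbours in common components, the component map loses at least
    two values. *)
Lemma excess_gt1 S x y z y' z' : x \in S ->
  y \in nbrs S x -> z \in nbrs S x -> y' \in nbrs S x -> z' \in nbrs S x ->
  y != z -> y' != z' -> connect (sub_adj (S :\ x)) y z ->
  connect (sub_adj (S :\ x)) y' z' -> y' \notin [set y; z] -> 1 < excess S x.
Proof.
move=> xS yN zN yN' zN' yz yz' cyz cyz' y'n.
pose f := component (S :\ x).
have fE a b : a \in nbrs S x -> b \in nbrs S x -> connect (sub_adj (S :\ x)) a b -> f a = f b.
  move=> aN bN ab; apply/eqP; rewrite component_eq //.
    by case/(nbrsP xS): aN.
  by case/(nbrsP xS): bN.
(* The neighbours [y'] and [b] can both be dropped without losing a component: [z'] stands for the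
   first and [a] for the second, and the choice of [b] different from [z'] keeps [z'] available. *)
have [a [b [ab bz' Eab]]] : exists a b, [/\ a != b, b != z' & [set a; b] = [set y; z]].
  have [yz0|yz0] := eqVneq y z'; last by exists z, y; rewrite eq_sym yz setUC.
  by exists y, z; split=> //; rewrite -yz0 eq_sym.
have aN : a \in nbrs S x.
  by have := set21 a b; rewrite Eab !inE => /orP[]/eqP ->; [have := yN | have := zN]; rewrite inE.
have bN : b \in nbrs S x.
  by have := set22 a b; rewrite Eab !inE => /orP[]/eqP ->; [have := yN | have := zN]; rewrite inE.
have fab : f a = f b.
  have fyz := fE _ _ yN zN cyz.
  have := set22 a b; have := set21 a b; rewrite Eab !inE.
  by move=> /orP[]/eqP -> /orP[]/eqP ->.
have y'a : y' != a by apply: contraNneq y'n => ->; rewrite -Eab set21.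
have y'b : y' != b by apply: contraNneq y'n => ->; rewrite -Eab set22.
have sub : nbr_components S x \subset f @: (nbrs S x :\ y' :\ b).
  apply/subsetP => B /imsetP[t tN ->]; rewrite -/(f t).
  have inT u : u \in nbrs S x -> u != y' -> u != b -> f u \in f @: (nbrs S x :\ y' :\ b).
    by move=> uN u1 u2; apply: imset_f; rewrite in_setD1 u2 in_setD1 u1.
  have [->|t1] := eqVneq t y'.
    rewrite (fE _ _ yN' zN' cyz'); apply: inT; rewrite // 1?eq_sym //.
  have [->|t2] := eqVneq t b; last exact: inT.
  by rewrite -fab; apply: inT; rewrite // eq_sym.
have le := leq_trans (subset_leq_card sub) (leq_imset_card f _).
rewrite /excess ltn_subRL (cardsD1 y' (nbrs S x)) yN' (cardsD1 b (_ :\ y')).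
by rewrite in_setD1 bN eq_sym y'b addn1 !ltnS.
Qed.

(** * Graphs with pairwise disjoint cycles *)

Section DisjointCycles.
Hypothesis dj : disjoint_cycles G.

Lemma disjoint_cycle_edges c1 c2 x : is_cycle G c1 -> is_cycle G c2 ->
  x \in c1 -> x \in c2 -> cycle_edges c1 = cycle_edges c2.
Proof.
move=> cc1 cc2 x1 x2; apply/eqP; apply: contraT => ne.
by have /pred0P/(_ x) := dj cc1 cc2 ne; rewrite /= x1 x2.
Qed.

Lemma disjoint_cycles_mem c1 c2 x : is_cycle G c1 -> is_cycle G c2 ->
  x \in c1 -> x \in c2 -> c1 =i c2.
Proof.
move=> cc1 cc2 x1 x2; have E := disjoint_cycle_edges cc1 cc2 x1 x2.
move=> t; apply/idP/idP => tc; have := cycle_edge_next tc.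
  by rewrite E => /(mem_cycle_edges cc2)[].
by rewrite -E => /(mem_cycle_edges cc1)[].
Qed.

(** The connection from [y] to [z] closes to a cycle through [x] containing the edge from [x] to
    [y]; meeting [c] at [x], it has the same edges as [c]. *)
Lemma disjoint_cycles_nbr c S x y z : is_cycle G c -> x \in c -> x \in S ->
  y \in nbrs S x -> z \in nbrs S x -> y != z -> connect (sub_adj (S :\ x)) y z ->
  y \in c /\ (y = next c x \/ y = prev c x).
Proof.
move=> cc xc xS yN zN yz cyz.
have [c' [cc' _ xc' ny _]] := cycle_through xS yN zN yz cyz.
have := cycle_edge_next xc'; rewrite ny (disjoint_cycle_edges cc' cc xc' xc).
move=> /(mem_cycle_edges cc)[_ yE]; split=> //.
by case: yE => ->; rewrite ?mem_next ?mem_prev.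
Qed.

(** A chord together with an arc of [c] would form another cycle through [x]. *)
Lemma disjoint_cycles_chordless c x y : is_cycle G c -> x \in c -> y \in c ->
  adj G x y -> y = next c x \/ y = prev c x.
Proof.
move=> cc xc yc xy; have [->|yn] := eqVneq y (next c x); first by left.
have xS : x \in [set t in c] by rewrite inE.
have yN : y \in nbrs [set t in c] x by rewrite !inE yc.
have nN : next c x \in nbrs [set t in c] x.
  by rewrite !inE mem_next xc next_cycle //; case/and3P: cc.
suff cyn : connect (sub_adj ([set t in c] :\ x)) y (next c x).
  by have [] := disjoint_cycles_nbr cc xc xS yN nN yn cyn.
have yx : y != x by apply: contraTneq xy => ->; rewrite adj_irr.
have /and3P[_ uc _] := cc.
have [i p ip] := rot_to xc; have := is_cycle_rot i c; rewrite ip cc => /and3P[_ up cp].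
rewrite -(next_rot i uc) ip.
have yp : y \in p.
  by move: yc; rewrite -(mem_rot i) ip inE (negPf yx).
case: p ip up cp yp => [//|n p] ip up cp yp; rewrite /= eqxx sub_adjC.
case/splitPl: yp up cp ip => p1 p2 yl up cp ip; rewrite -yl; apply: path_connect.
  by move: cp; rewrite (cycle_path x) /= cat_path => /and4P[_ _ -> _].
move=> t tp; have tnp : t \in n :: p1 ++ p2 by rewrite -cat_cons mem_cat tp.
rewrite in_setD1 inE -(mem_rot i) ip inE tnp orbT andbT.
by case/andP: up => nx _; apply: contraNneq nx => <-.
Qed.

(** An edge leaving a cycle is a bridge: otherwise it would lie on a second cycle through [x]. *)
Lemma disjoint_cycles_bridge c x y z : is_cycle G c -> x \in c -> z \notin c ->
  adj G x y -> adj G x z -> y != z -> ~~ connect (sub_adj (setT :\ x)) y z.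
Proof.
move=> cc xc zc xy xz yz; apply: contra zc; rewrite sub_adjC => cyz.
have N t : adj G x t -> t \in nbrs setT x by move=> xt; rewrite !inE.
by have [] := disjoint_cycles_nbr cc xc (in_setT x) (N _ xz) (N _ xy) _ cyz; rewrite 1?eq_sym.
Qed.

Definition cycles_in S : {set {set V}} := [set C in cycle_sets G | C \subset S].

(** At most one cycle passes through [x], and it accounts for the whole excess. *)
Lemma cycles_in_delete S x : x \in S ->
  #|cycles_in S| = #|cycles_in (S :\ x)| + excess S x.
Proof.
move=> xS.
have E1 : cycles_in (S :\ x) = [set C in cycles_in S | x \notin C].
  by apply/setP => C; rewrite !inE subsetD1 andbA.
have -> : #|cycles_in S| = #|cycles_in (S :\ x)| + #|[set C in cycles_in S | x \in C]|.
  rewrite E1 -(cardsID [set C : {set V} | x \in C] (cycles_in S)) addnC.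
  by congr (_ + _); apply: eq_card => C; rewrite !inE // andbC.
congr (_ + _); case: (posnP (excess S x)) => [e0|e_gt0].
  rewrite e0; apply/eqP; rewrite cards_eq0; apply/eqP/setP => C; rewrite in_set0.
  apply/negP => CP; suff : 0 < excess S x by rewrite e0.
  apply/(excess_gt0P xS); move: CP; rewrite [C \in _]inE => /andP[].
  rewrite inE => /andP[/cycle_setsP[c cc CE] CS] xC.
  have cS : {subset c <= S} by move=> t tc; apply: (subsetP CS); rewrite CE inE.
  have xc : x \in c by rewrite CE inE in xC.
  by have [] := cycle_nbrs cc cS xc; exists (next c x), (prev c x).
have [y [z [yN zN yz cyz]]] := excess_gt0P xS e_gt0.
have [c [cc cS xc ny pz]] := cycle_through xS yN zN yz cyz.
have -> : [set C in cycles_in S | x \in C] = [set [set t in c]].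
  apply/setP => C; rewrite in_set1; apply/idP/eqP.
    rewrite [C \in _]inE => /andP[]; rewrite inE => /andP[/cycle_setsP[c' cc' ->] _].
    by rewrite inE => xc'; apply/setP => t; rewrite !inE (disjoint_cycles_mem cc' cc xc' xc).
  move=> ->; rewrite inE [x \in _]inE xc andbT inE; apply/andP; split.
    by apply/cycle_setsP; exists c.
  by apply/subsetP => t; rewrite inE => /cS.
(* The excess is at most 1: two distinct neighbours in a common component are the successor [y] and
   the predecessor of [x] on [c], so the component map is injective once [y] is removed. *)
rewrite cards1; apply/eqP; rewrite eqn_leq e_gt0 /= /excess leq_subLR addn1.
suff : #|nbrs S x :\ y| <= #|nbr_components S x| by rewrite (cardsD1 y (nbrs S x)) yN ltnS.
rewrite -(card_in_imset (f := component (S :\ x))).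
  by apply/subset_leq_card/imsetS/subsetDl.
move=> a b; rewrite !in_setD1 => /andP[ay aN] /andP[bY bN] /eqP.
rewrite component_eq; [|by case/(nbrsP xS): aN|by case/(nbrsP xS): bN].
move=> cab; apply/eqP; apply: contraT => ab.
have [_ aE] := disjoint_cycles_nbr cc xc xS aN bN ab cab.
have [_ bE] : b \in c /\ (b = next c x \/ b = prev c x).
  by apply: (disjoint_cycles_nbr cc xc xS bN aN); rewrite 1?eq_sym // sub_adjC.
case: aE bE => [aE|aE] [bE|bE]; move: ay bY ab; rewrite aE bE -?ny ?eqxx //.
Qed.

Lemma cycle_rank_cycles S : cycle_rank S = #|cycles_in S|.
Proof.
have [n] := ubnP #|S|; elim: n S => // n IH S.
have [->|[x xS]] := set_0Vmem S.
  move=> _; rewrite cycle_rank0; apply/esym/eqP; rewrite cards_eq0; apply/eqP/setP => C.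
  rewrite !inE subset0; apply/negbTE/andP => -[+ /eqP C0].
  move=> /existsP[t /andP[/and3P[+ _ _] _]]; rewrite size_tuple C0 cards0 //.
rewrite (cardsD1 x) xS ltnS => /IH E.
by rewrite (cycle_rank_delete xS) (cycles_in_delete xS) E.
Qed.

End DisjointCycles.

(** At a common vertex of two cycles, [excess_gt1] forces the successor on one to be a neighbour
    along the other. Walking on, one cycle stays inside the other and uses its edges, so the two
    coincide. *)
Lemma excess_disjoint_cycles : (forall x, excess setT x <= 1) -> disjoint_cycles G.
Proof.
move=> ex c1 c2 cc1 cc2; apply: contraR => /pred0Pn[x /andP[/= x1 x2]].
have ucT (c : seq V) : {subset c <= [set: V]} by move=> t; rewrite inE.
have same c c' t : is_cycle G c -> is_cycle G c' -> t \in c -> t \in c' ->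
    next c t = next c' t \/ next c t = prev c' t.
  move=> cc cc' tc tc'.
  have [nN pN np cnp] := cycle_nbrs cc (ucT c) tc.
  have [nN' pN' np' cnp'] := cycle_nbrs cc' (ucT c') tc'.
  apply/pred2P; apply: contraT => nn.
  have := excess_gt1 (in_setT t) nN' pN' nN pN np' np cnp' cnp; rewrite !inE nn => /(_ isT).
  by rewrite ltnNge ex.
have sub c c' : is_cycle G c -> is_cycle G c' -> x \in c -> x \in c' ->
    {subset c <= c'} .
  move=> cc cc' xc xc'; have /and3P[_ uc cyc] := cc.
  have step t : t \in c -> t \in c' -> next c t \in c'.
    by move=> tc tc'; case: (same c c' t cc cc' tc tc') => ->; rewrite ?mem_next ?mem_prev.
  have [i p ip] := rot_to xc.
  have stepr t : t \in x :: p -> t \in c' -> next (x :: p) t \in c'.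
    by rewrite -ip mem_rot next_rot //; apply: step.
  have upx : uniq (x :: p) by rewrite -ip rot_uniq.
  move=> t; rewrite -(mem_rot i) ip => /(nthP x)[k kl <-] {t}.
  elim: k kl => [|k IH] kl //=.
  have kl' : k < size (x :: p) by apply: ltnW.
  have := stepr (nth x (x :: p) k) (mem_nth _ kl') (IH kl').
  by rewrite next_nth mem_nth // index_uniq.
have subE c c' : is_cycle G c -> is_cycle G c' -> x \in c -> x \in c' ->
    cycle_edges c \subset cycle_edges c'.
  move=> cc cc' xc xc'; apply/subsetP => e /imsetP[t tc ->].
  have tc' := sub c c' cc cc' xc xc' t tc.
  case: (same c c' t cc cc' tc tc') => ->; first exact: cycle_edge_next.
  exact: cycle_edge_prev.
by rewrite eqEsubset !subE.
Qed.

(** * Matchings *)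

(* A matching is encoded by the involution exchanging matched vertices and fixing the
   others; [max_matched] is thus twice the matching number. *)
Definition matching_fun S (f : {ffun V -> V}) : bool :=
  [forall x, (f (f x) == x) && ((f x != x) ==> (x \in S) && adj G x (f x))].

Definition matched_set (f : {ffun V -> V}) : {set V} := [set x | f x != x].

Definition max_matched S : nat := \max_(f | matching_fun S f) #|matched_set f|.

Lemma matching_funP S (f : {ffun V -> V}) :
  reflect (involutive f /\ forall x, f x != x -> x \in S /\ adj G x (f x))
          (matching_fun S f).
Proof.
apply: (iffP forallP) => [H|[H1 H2] x].
  split=> x; first by case/andP: (H x) => /eqP.
  by case/andP: (H x) => _ /implyP h /h/andP[].
by rewrite H1 eqxx /=; apply/implyP => /H2[-> ->].
Qed.

Lemma matching_fun_id S : matching_fun S [ffun x => x].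
Proof. by apply/matching_funP; split=> x; rewrite !ffunE ?eqxx. Qed.

Lemma max_matchedP S f : matching_fun S f -> #|matched_set f| <= max_matched S.
Proof. exact: leq_bigmax_cond. Qed.

Lemma max_matched_ex S : exists2 f, matching_fun S f & #|matched_set f| = max_matched S.
Proof.
have [|f fm E] := @eq_bigmax_cond _ (matching_fun S) (fun f => #|matched_set f|).
  by apply/card_gt0P; exists [ffun x => x]; apply: matching_fun_id.
by exists f; [exact: fm | exact: esym E].
Qed.

Lemma matching_funS S T f : S \subset T -> matching_fun S f -> matching_fun T f.
Proof.
move=> /subsetP ST /matching_funP[f1 f2]; apply/matching_funP; split=> // x /f2[/ST].
by [].
Qed.

Lemma max_matchedS S T : S \subset T -> max_matched S <= max_matched T.
Proof.
by move=> ST; apply/bigmax_leqP => f /(matching_funS ST)/max_matchedP.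
Qed.

Lemma invol_even (f : V -> V) S : involutive f ->
  (forall x, x \in S -> f x \in S /\ f x != x) -> ~~ odd #|S|.
Proof.
move=> ff; have [n] := ubnP #|S|; elim: n S => // n IH S.
have [->|[x xS]] := set_0Vmem S; first by rewrite cards0.
move=> le H; have [fxS fx] := H x xS.
have E : #|S| = #|S :\ x :\ f x|.+2.
  by rewrite (cardsD1 x) xS (cardsD1 (f x)) in_setD1 fxS fx.
rewrite E /= negbK; apply: IH; first by rewrite E in le; apply: ltnW.
move=> t; rewrite !in_setD1 => /and3P[t1 t2 /H[ftS ftt]].
rewrite ftS ftt andbT (inj_eq (can_inj ff)) t2; split=> //.
by apply: contraNneq t1 => <-; rewrite ff.
Qed.

Lemma matched_set_even S f : matching_fun S f -> ~~ odd #|matched_set f|.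
Proof.
move=> /matching_funP[ff _]; apply: (invol_even ff) => x; rewrite !inE ff.
by rewrite eq_sym.
Qed.

Lemma max_matched_even S : ~~ odd (max_matched S).
Proof. by have [f /matched_set_even + <-] := max_matched_ex S. Qed.

Definition add_edge (f : {ffun V -> V}) x y : {ffun V -> V} :=
  [ffun t => if t == x then y else if t == y then x else f t].

Lemma add_edge_matching S f x y : matching_fun S f -> x \in S -> y \in S ->
  adj G x y -> f x = x -> f y = y ->
  matching_fun S (add_edge f x y)
  /\ #|matched_set (add_edge f x y)| = #|matched_set f| + 2.
Proof.
move=> /matching_funP[ff fS] xS yS xy fx fy.
have yx : y != x by apply: contraTneq xy => ->; rewrite adj_irr.
have fn t : t != x -> t != y -> (f t != x) && (f t != y).
  move=> tx ty; apply/andP; split.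
    by apply: contraNneq tx => E; rewrite -(ff t) E fx.
  by apply: contraNneq ty => E; rewrite -(ff t) E fy.
split.
  apply/matching_funP; split=> t; rewrite !ffunE.
    have [->|tx] := eqVneq t x; first by rewrite (negPf yx) eqxx.
    have [->|ty] := eqVneq t y; first by rewrite eqxx.
    by have /andP[/negPf -> /negPf ->] := fn t tx ty.
  have [->|tx] := eqVneq t x; first by rewrite xS.
  have [->|ty] := eqVneq t y; first by rewrite yS adj_sym.
  exact: fS.
have E : matched_set (add_edge f x y) = x |: (y |: matched_set f).
  apply/setP => t; rewrite !inE !ffunE; have [->|tx] := eqVneq t x; first by rewrite yx.
  by have [->|ty] := eqVneq t y; first by rewrite eq_sym yx.
by rewrite E !cardsU1 !inE fx fy !eqxx eq_sym (negPf yx) /= addnA addnC.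
Qed.

Definition del_edge (f : {ffun V -> V}) x : {ffun V -> V} :=
  [ffun t => if (t == x) || (t == f x) then t else f t].

(** An inequality only, since nothing is removed when [x] is unmatched. *)
Lemma del_edge_matching S f x : matching_fun S f ->
  matching_fun S (del_edge f x)
  /\ #|matched_set f| <= #|matched_set (del_edge f x)| + 2.
Proof.
move=> /matching_funP[ff fS]; split.
  apply/matching_funP; split=> t; rewrite !ffunE.
    have [->|tx] := eqVneq t x; first by rewrite /= eqxx.
    have [->|tfx] := eqVneq t (f x); first by rewrite /= eqxx orbT.
    rewrite /= (inj_eq (can_inj ff)) (negPf tx) orbF ff ifN //.
    by apply: contraNneq tfx => <-; rewrite ff.
  by case: ifP => [_|_ /fS//]; rewrite eqxx.
have -> : matched_set f = matched_set f :\ x :\ f x :|: [set x; f x] :&: matched_set f.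
  apply/setP => t; rewrite !inE; case: (t == x); case: (t == f x);
  by rewrite ?andbF ?orbF ?andbT.
apply: leq_trans (leq_card_setU _ _) _; apply: leq_add.
  apply/subset_leq_card/subsetP => t; rewrite !inE ffunE => /and3P[t1 t2 t3].
  by rewrite (negPf t1) (negPf t2).
by apply: leq_trans (subset_leq_card (subsetIl _ _)) _; rewrite cards2; case: eqP.
Qed.

(** * Vertex covers and Koenig's theorem for forests *)

Definition vertex_cover S (A : {set V}) : bool :=
  [forall x in S, forall y in S, adj G x y ==> (x \in A) || (y \in A)].

Lemma vertex_coverP S (A : {set V}) :
  reflect (forall x y, x \in S -> y \in S -> adj G x y -> (x \in A) || (y \in A))
          (vertex_cover S A).
Proof.
apply: (iffP forall_inP) => H; first by move=> x y /H/forall_inP h /h/implyP; apply.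
by move=> x xS; apply/forall_inP => y yS; apply/implyP/H.
Qed.

Lemma matched_cover S (A : {set V}) f : matching_fun S f -> vertex_cover S A ->
  #|matched_set f| <= 2 * #|A|.
Proof.
move=> /matching_funP[ff fS] /vertex_coverP cA.
apply: (@leq_trans #|A :|: f @: A|); last first.
  apply: leq_trans (leq_card_setU _ _) _; rewrite mul2n -addnn leq_add2l.
  exact: leq_imset_card.
apply/subset_leq_card/subsetP => x; rewrite !inE => fx.
have [xS xy] := fS x fx; have [fxS _] : f x \in S /\ adj G (f x) (f (f x)).
  by apply: fS; rewrite ff eq_sym.
case/orP: (cA _ _ xS fxS xy) => [->//|fA]; apply/orP; right.
by rewrite -(ff x); apply: imset_f.
Qed.

(** In a nonempty forest the degree sum is less than twice the number of vertices. *)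
Lemma acyclic_low_degree S : cycle_rank S = 0 -> S != set0 ->
  exists2 x, x \in S & #|nbrs S x| <= 1.
Proof.
move=> S0 /set0Pn[x0 x0S]; apply/exists_inP; apply: contraT => /exists_inPn H.
have := cycle_rankE S; rewrite S0 muln0 addn0.
have : 0 < #|components S|.
  by apply/card_gt0P; exists (component S x0); apply: imset_f.
have : 2 * #|S| <= degree_sum S.
  rewrite mulnC -sum_nat_const; apply: leq_sum => x /H.
  by rewrite -ltnNge.
lia.
Qed.

(** Induction on vertices of degree at most one: a leaf [x] is matched to its neighbour [u], which
    joins the cover, and both are deleted; an isolated vertex is simply dropped. *)
Theorem koenig_forest S : cycle_rank S = 0 -> exists (A : {set V}) (f : {ffun V -> V}),
  [/\ A \subset S, vertex_cover S A, matching_fun S f & #|matched_set f| = 2 * #|A|].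
Proof.
have [n] := ubnP #|S|; elim: n S => // n IH S le S0.
have [SE|Sn0] := eqVneq S set0.
  exists set0, [ffun x => x]; split; first exact: sub0set.
  - by apply/vertex_coverP => x y; rewrite SE inE.
  - exact: matching_fun_id.
  - rewrite cards0 muln0; apply/eqP; rewrite cards_eq0; apply/eqP/setP => x.
    by rewrite !inE ffunE eqxx.
have [x xS] := acyclic_low_degree S0 Sn0.
rewrite leq_eqVlt ltnS leqn0 => /orP[/cards1P[u nE]|/eqP/cards0_eq nE].
  have uN : u \in nbrs S x by rewrite nE set11.
  have [uT uS xu] := nbrsP xS uN.
  have sub : S :\ x :\ u \subset S by apply/subsetP => t; rewrite !inE => /and3P[].
  have cardE : #|S| = #|S :\ x :\ u|.+2 by rewrite (cardsD1 x) xS (cardsD1 u) uT.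
  have [||A [f [AS cA fm fA]]] := IH (S :\ x :\ u).
  - by rewrite -ltnS; apply: leq_trans le; rewrite cardE; exact: leqnSn.
  - by apply/eqP; rewrite -leqn0 -S0 cycle_rankS.
  have /matching_funP[ff fS] := fm.
  have [] := @add_edge_matching S f x u (matching_funS sub fm) xS uS xu.
  - by apply/eqP; apply: contraT => /fS[]; rewrite !inE eqxx andbF.
  - by apply/eqP; apply: contraT => /fS[]; rewrite !inE eqxx.
  move=> m1 m2; exists (u |: A), (add_edge f x u); split=> //.
  - by apply/subsetP => t /setU1P[->//|/(subsetP AS)/(subsetP sub)].
  - apply/vertex_coverP => y z yS zS yz; rewrite !inE.
    have xN t : t \in S -> adj G x t -> t = u.
      by move=> tS xt; apply/set1P; rewrite -nE inE tS.
    have [->|yu] := eqVneq y u => //=; have [->|zu] := eqVneq z u => /=; first by rewrite orbT.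
    have yx : y != x by apply: contraNneq zu => yx; rewrite (xN z) // -yx.
    have zx : z != x by apply: contraNneq yu => zx; rewrite (xN y) // -zx adj_sym.
    by apply: (vertex_coverP _ _ cA) => //; rewrite !inE ?yu ?yx ?zu ?zx.
  - rewrite m2 fA cardsU1.
    have -> : u \notin A by apply/negP => /(subsetP AS); rewrite !inE eqxx.
    by rewrite /= mulnDr muln1 addnC.
have [||A [f [AS cA fm fA]]] := IH (S :\ x).
- by rewrite -ltnS; apply: leq_trans le; rewrite [#|S|](cardsD1 x) xS; exact: leqnn.
- by apply/eqP; rewrite -leqn0 -S0 cycle_rankS // subsetDl.
exists A, f; split=> //.
- exact: subset_trans AS (subsetDl _ _).
- apply/vertex_coverP => y z yS zS yz.
  have xN t : t \in S -> ~~ adj G x t.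
    move=> tS; apply/negP => xt; have : t \in nbrs S x by rewrite inE tS.
    by rewrite nE inE.
  have yx : y != x by apply: contraTneq yz => ->; apply: xN.
  have zx : z != x by apply: contraTneq yz => ->; rewrite adj_sym; apply: xN.
  by apply: (vertex_coverP _ _ cA) => //; rewrite !inE ?yx ?zx.
- exact: matching_funS (subsetDl _ _) fm.
Qed.

(** * Matchings as involutions and as sets of edges *)

Definition edges_of (f : {ffun V -> V}) : {set {set V}} :=
  [set [set x; f x] | x in matched_set f].

Lemma edges_of_matching f : matching_fun setT f ->
  is_matching G (edges_of f) /\ #|matched_set f| = 2 * #|edges_of f|.
Proof.
move=> /matching_funP[ff fS].
have mem x e : e \in edges_of f -> x \in e -> e = [set x; f x] /\ f x != x.
  case/imsetP => y; rewrite !inE => fy -> /set2P[->//|->]; rewrite ff setUC.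
  by rewrite eq_sym.
have triv : trivIset (edges_of f).
  apply/trivIsetP => A B AM BM; apply: contraR => /pred0Pn[x /andP[/= xA xB]].
  by have [-> _] := mem _ _ AM xA; have [-> _] := mem _ _ BM xB.
split.
  rewrite /is_matching triv andbT; apply/subsetP => e /imsetP[x].
  rewrite inE => fx ->; apply/imsetP; exists (x, f x) => //=.
  by rewrite inE; have [_] := fS x fx.
have -> : matched_set f = cover (edges_of f).
  apply/setP => x; apply/idP/bigcupP => [xm|[e eM xe]].
    by exists [set x; f x]; rewrite ?set21 //; apply: imset_f.
  by rewrite inE; have [] := mem x e eM xe.
rewrite -(eqP triv) mulnC -sum_nat_const; apply: eq_bigr => e /imsetP[x].
by rewrite inE eq_sym => fx ->; rewrite cards2 fx.
Qed.

Lemma matching_fun_of M : is_matching G M -> exists f : {ffun V -> V},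
  [/\ matching_fun setT f, #|matched_set f| = 2 * #|M|
    & forall x, f x != x -> [set x; f x] \in M].
Proof.
case/andP=> sM tM.
pose f := [ffun x => if [pick y | [set x; y] \in M] is Some y then y else x].
have edge x y : [set x; y] \in M -> adj G x y.
  move=> /(subsetP sM)/imsetP[[a b]]; rewrite inE /= => ab E.
  have nab : a != b by apply: contraTneq ab => ->; rewrite adj_irr.
  have nxy : x != y.
    apply: contraNneq nab => xy; have := set21 a b; have := set22 a b.
    by rewrite -E xy !inE !orbb => /eqP -> /eqP ->.
  have := set21 x y; have := set22 x y; rewrite E !inE.
  by case/orP=> /eqP yE; case/orP => /eqP xE; rewrite xE yE ?eqxx // adj_sym in nxy *.
have uq e e' x : e \in M -> e' \in M -> x \in e -> x \in e' -> e = e'.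
  move=> eM eM' xe xe'; apply/eqP; apply: contraT => ne.
  by have /trivIsetP/(_ _ _ eM eM' ne)/pred0P/(_ x) := tM; rewrite /= xe xe'.
have fE x y : [set x; y] \in M -> f x = y.
  move=> xy; rewrite ffunE; case: pickP => [z xz|/(_ y)]; last by rewrite xy.
  have E := uq _ _ x xz xy (set21 _ _) (set21 _ _).
  have := set22 x z; rewrite E => /set2P[zx|//].
  by have := edge _ _ xz; rewrite zx adj_irr.
have fM x : f x != x -> [set x; f x] \in M.
  by rewrite ffunE; case: pickP => // _; rewrite eqxx.
have fm : matching_fun setT f.
  apply/matching_funP; split=> x.
    have [E|/fM xM] := eqVneq (f x) x; first by rewrite !E.
    by apply: fE; rewrite setUC.
  by move=> /fM/edge; rewrite inE.
exists f; split=> //.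
have [_ ->] := edges_of_matching fm; congr (2 * #|pred_of_set _|).
apply/setP => e; apply/imsetP/idP => [[x]|eM]; first by rewrite inE => /fM + ->.
have /imsetP[[a b]] := subsetP sM e eM; rewrite inE /= => ab E.
have nab : a != b by apply: contraTneq ab => ->; rewrite adj_irr.
by exists a; rewrite ?inE (fE a b) -?E // eq_sym.
Qed.

Lemma max_matched_number : max_matched setT = 2 * matching_number G.
Proof.
apply/eqP; rewrite eqn_leq; apply/andP; split.
  have [f fm <-] := max_matched_ex setT; have [m ->] := edges_of_matching fm.
  by rewrite leq_mul2l /=; apply: (leq_bigmax_cond (edges_of f)).
have [|M mM E] := @eq_bigmax_cond _ (is_matching G) (fun M => #|M|).
  apply/card_gt0P; exists set0; rewrite unfold_in /is_matching sub0set.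
  by apply/trivIsetP => A B; rewrite inE.
have [f [fm fM _]] := matching_fun_of mM; rewrite /matching_number.
by move: (max_matchedP fm); rewrite fM -E.
Qed.

(** * Exchanging matchings across a bridge and around a cycle *)

Definition glue (K : {set V}) (f g : {ffun V -> V}) : {ffun V -> V} :=
  [ffun x => if x \in K then f x else g x].

Lemma glue_matching S (K : {set V}) f g : matching_fun S f -> matching_fun S g ->
  (forall x, (f x \in K) = (x \in K)) -> (forall x, (g x \in K) = (x \in K)) ->
  matching_fun S (glue K f g).
Proof.
move=> /matching_funP[ff fS] /matching_funP[gg gS] fK gK.
apply/matching_funP; split=> x; rewrite !ffunE; case: (boolP (x \in K)) => xK.
- by rewrite fK xK ff.
- by rewrite gK (negPf xK) gg.
- exact: fS.
- exact: gS.
Qed.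

Lemma card_glue (K : {set V}) f g :
  #|matched_set (glue K f g)| + #|matched_set (glue K g f)|
  = #|matched_set f| + #|matched_set g|.
Proof.
have D (h k : {ffun V -> V}) :
    #|matched_set (glue K h k)| = #|matched_set h :&: K| + #|matched_set k :\: K|.
  rewrite -(cardsID K (matched_set _)); congr (_ + _); apply: eq_card => x;
  by rewrite !inE ffunE; case: (x \in K); rewrite ?andbF ?andbT.
rewrite !D -(cardsID K (matched_set f)) -(cardsID K (matched_set g)).
rewrite [LHS]addnACA [RHS]addnACA.
by congr (_ + _); rewrite addnC.
Qed.

(* Let K be the side of z.  Exchanging f1 and f2 on K turns them into two matchings, one of
   which misses both x and z; their sizes add up to the same total, so that this one, once
   completed by the edge xz, or the other one, is larger than f1 and f2. *)
Lemma bridge_inessential c x z f1 f2 : disjoint_cycles G ->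
  is_cycle G c -> x \in c -> z \notin c -> adj G x z ->
  matching_fun setT f1 -> matching_fun setT f2 ->
  #|matched_set f1| = max_matched setT -> #|matched_set f2| = max_matched setT ->
  f1 x = x -> f2 z != z.
Proof.
move=> dj cc xc zc xz m1 m2 e1 e2 f1x; apply/eqP => f2z.
pose K := component (setT :\ x) z.
have zx : z != x by apply: contraTneq xz => ->; rewrite adj_irr.
have pres f : matching_fun setT f -> (forall y, y \in K -> f y != x) ->
    forall y, (f y \in K) = (y \in K).
  move=> /matching_funP[ff fS] fx.
  have imp y : y \in K -> f y \in K.
    move=> yK; have [-> //|/fS[_ yfy]] := eqVneq (f y) y.
    have fyx := fx y yK; move: yK; rewrite !inE fyx => /andP[yx zy].
    apply: (connect_trans zy); apply: connect1.
    by rewrite /sub_adj !inE yfy yx fyx.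
  by move=> y; apply/idP/idP => /imp //; rewrite ff.
have /matching_funP[ff1 _] := m1; have /matching_funP[ff2 fS2] := m2.
have p1 : forall y, (f1 y \in K) = (y \in K).
  apply: pres => // y; rewrite !inE => /andP[/andP[yx _] _].
  by apply: contraNneq yx => E; rewrite -(ff1 y) E f1x.
have p2 : forall y, (f2 y \in K) = (y \in K).
  apply: pres => // y; rewrite !inE => /andP[/andP[yx _] zy].
  apply: contraL zy => /eqP E; rewrite sub_adjC.
  have yz : y != z by apply: contraNneq zx => yz; rewrite -E yz f2z.
  have [|_ xy] := fS2 y; first by rewrite E eq_sym.
  by rewrite E adj_sym in xy; apply: (disjoint_cycles_bridge dj cc).
have m3 := glue_matching m2 m1 p2 p1; have m4 := glue_matching m1 m2 p1 p2.
have xK : x \notin K by rewrite !inE eqxx.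
have zK : z \in K by apply: component_self; rewrite !inE zx.
have [||m5 e5] := add_edge_matching m3 (in_setT x) (in_setT z) xz.
- by rewrite ffunE (negPf xK).
- by rewrite ffunE zK.
have := max_matchedP m5; have := max_matchedP m4; have := card_glue K f2 f1.
by rewrite e5 e1 e2 => E l1 l2; have := leq_add l2 l1; rewrite addnAC E addn2 ltnNge leqnSn.
Qed.

(* If f misses p(2k) then it matches p(2k+1) to some w.  Matching p(2k+1) to p(2k) instead
   gives a maximum matching that misses w; the bridge lemma puts w on the cycle, hence
   w = p(2k+2), and the walk goes on from there. *)
Lemma matching_missing_cycle c f p0 : disjoint_cycles G ->
  (forall c' x, is_cycle G c' -> x \in c' -> max_matched (setT :\ x) = max_matched setT) ->
  is_cycle G c -> matching_fun setT f -> #|matched_set f| = max_matched setT ->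
  p0 \in c -> f p0 = p0 -> odd (size c) /\ forall x, x \in c -> f x \in c.
Proof.
move=> dj iness cc fm fmax p0c fp0.
have /and3P[_ uc cyc] := cc.
have [i s ip] := rot_to p0c; set c' := p0 :: s in ip.
have uc' : uniq c' by rewrite -ip rot_uniq.
have mc x : (x \in c) = (x \in c') by rewrite -ip mem_rot.
have -> : size c = size c' by rewrite -ip size_rot.
pose p k := nth p0 c' k.
have tk k n : k < size c' -> (p k \in take n c') = (k < n).
  by move=> kc; rewrite in_take ?mem_nth // index_uniq.
have pc k : k < size c' -> p k \in c by move=> kc; rewrite mc mem_nth.
have pn k : k < size c' -> next c (p k) = if k.+1 < size c' then p k.+1 else p0.
  move=> kc; rewrite -(next_rot i uc) ip next_nth mem_nth // index_uniq //.
  by case: ltnP => // ?; apply: nth_default.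
(* Here [g] is maximum, misses p(2k), agrees with [f] beyond the first 2k + 1 vertices of the walk
   and maps these to themselves. *)
pose Inv k := exists g, [/\ matching_fun setT g, #|matched_set g| = max_matched setT,
  g (p k.*2) = p k.*2, forall v, v \notin take k.*2.+1 c' -> g v = f v
  & forall v, v \in take k.*2.+1 c' -> g v \in take k.*2.+1 c'].
have Inv0 : Inv 0.
  exists f; split=> // v; rewrite take_cons take0 !inE => /eqP ->.
  by rewrite fp0.
have step k : k.*2.+1 < size c' -> Inv k -> k.*2.+2 < size c' /\ Inv k.+1.
  move=> kc [g [gm gmax ga gf gT]].
  have kc0 := ltnW kc; set a := p k.*2 in ga; set b := p k.*2.+1.
  have nab : next c a = b by rewrite pn ?kc.
  have ab : adj G a b by rewrite -nab next_cycle ?pc.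
  have ba : b != a by apply: contraTneq ab => ->; rewrite adj_irr.
  have /matching_funP[gg gS] := gm.
  set w := g b.
  have wb : w != b.
    apply/eqP => gb; have [m5 e5] := add_edge_matching gm (in_setT a) (in_setT b) ab ga gb.
    by have := max_matchedP m5; rewrite e5 gmax addn2 ltnNge leqnSn.
  have wa : w != a by apply: contraNneq ba => wa; rewrite -(gg b) -/w wa ga.
  have wT : w \notin take k.*2.+1 c'.
    by apply/negP => /gT; rewrite gg tk // ltnn.
  have [_ bw] := gS b wb; rewrite -/w in bw.
  have [gm1 gmax1] := del_edge_matching b gm.
  have [||m5 e5] := add_edge_matching gm1 (in_setT a) (in_setT b) ab.
  - by rewrite ffunE ga if_same.
  - by rewrite ffunE eqxx.
  set g2 := add_edge _ a b in m5 e5.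
  have max5 : #|matched_set g2| = max_matched setT.
    by apply/eqP; rewrite eqn_leq max_matchedP //= e5 -gmax.
  have g2w : g2 w = w by rewrite !ffunE (negPf wa) (negPf wb) eqxx orbT.
  have bc : b \in c by apply: pc.
  have wc : w \in c.
    apply: contraT => wc.
    have [h hm hmax] := max_matched_ex (setT :\ b).
    have hb : h b = b.
      case/matching_funP: hm => _ hS.
      by apply/eqP; apply: contraT => /hS[]; rewrite !inE eqxx.
    have := bridge_inessential dj cc bc wc bw (matching_funS (subsetT _) hm) m5 _ max5 hb.
    by rewrite hmax (iness c) // g2w eqxx => /(_ erefl).
  have wE : w = next c b.
    case: (disjoint_cycles_chordless dj cc bc wc bw) => // wp.
    by move: wa; rewrite wp -nab prev_next // eqxx.
  have kc2 : k.*2.+2 < size c'.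
    apply: contraT => kc2; move: wT.
    by rewrite wE pn // (negPf kc2) -[p0]/(p 0) tk.
  have wp : w = p k.*2.+2 by rewrite wE pn // kc2.
  split=> //; exists g2; rewrite doubleS.
  have tkS n v : n < size c' -> v \in take n.+1 c' = (v \in take n c') || (v == p n).
    by move=> nc; rewrite (take_nth p0 nc) mem_rcons inE orbC.
  have tks v : v \in take k.*2.+3 c' = [|| v \in take k.*2.+1 c', v == b | v == w].
    by rewrite !tkS // wp -!orbA.
  have aT : a \in take k.*2.+1 c' by rewrite tk.
  split=> //; first by rewrite -wp.
    move=> v; rewrite tks 2!negb_or => /and3P[vT vb vw].
    have va : v != a by apply: contraNneq vT => ->.
    by rewrite !ffunE (negPf va) (negPf vb) (negPf vw) /= gf.
  move=> v; rewrite !tks !ffunE.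
  have [->|va] := eqVneq v a; first by rewrite eqxx orbT.
  have [->|vb] := eqVneq v b; first by rewrite aT.
  have [->|vw] := eqVneq v w; first by rewrite eqxx /= !orbT.
  by rewrite !orbF => /gT ->.
have Invk k : k.*2 < size c' -> Inv k.
  elim: k => [//|k IH]; rewrite doubleS => kc.
  by have [] := step k (ltnW kc) (IH (ltnW (ltnW kc))).
(* For even q, the step from p(q - 2) would require a further vertex p(q). *)
have od : odd (size c').
  apply: contraT => ev; have := even_halfK ev.
  case E : (size c')./2 => [|k]; first by rewrite double0.
  rewrite doubleS => sE.
  have kc : k.*2.+1 < size c' by rewrite -sE.
  by have [] := step k kc (Invk k (ltnW kc)); rewrite -sE ltnn.
split=> //.
(* At k = (q - 1) / 2 the invariant covers the whole cycle: [g] preserves it and agrees with [f]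
   elsewhere, so [f] cannot match a vertex of the cycle to an outer one. *)
have sE : (size c')./2.*2.+1 = size c' by rewrite -[RHS]odd_double_half od.
have [|g [gm _ _ gf gT]] := Invk (size c')./2; first by rewrite -{2}sE.
rewrite sE take_size in gf gT.
have /matching_funP[gg _] := gm; have /matching_funP[ff _] := fm.
move=> x; rewrite !mc => xc; apply: contraT => fxc.
by have := gT _ xc; rewrite -{1}(ff x) -gf // gg (negPf fxc).
Qed.

(** The rank is the sum of the excesses met while deleting the vertices, and an excess that is
    positive in a smaller set stays positive in [S]. *)
Lemma cycle_rank_gt0 S : 0 < cycle_rank S -> exists2 x, x \in S & 0 < excess S x.
Proof.
have [n] := ubnP #|S|; elim: n S => // n IH S.
have [->|[x xS]] := set_0Vmem S; first by rewrite cycle_rank0.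
rewrite (cardsD1 x) xS ltnS => le; rewrite (cycle_rank_delete xS) => gt0.
have [e0|] := posnP (excess S x); last by exists x.
have [|y yS q] := IH _ le; first by rewrite e0 addn0 in gt0.
have sub : S :\ x \subset S by exact: subsetDl.
have yS' := subsetP sub y yS; exists y => //; apply/(excess_gt0P yS').
have [a [b [aN bN ab cab]]] := excess_gt0P yS q.
have N t : t \in nbrs (S :\ x) y -> t \in nbrs S y.
  by rewrite !inE => /andP[/andP[_ ->]].
exists a, b; split; rewrite ?N //; apply: sub_adjS cab.
exact: setSD.
Qed.

Lemma cycle_rank_cycle c S : is_cycle G c -> {subset c <= S} -> 0 < cycle_rank S.
Proof.
move=> cc cS; have /and3P[sz _ _] := cc.
case: c sz cc cS => [//|x c] _ cc cS.
have xS : x \in S by apply: cS; rewrite mem_head.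
rewrite (cycle_rank_delete xS); apply: leq_trans (leq_addl _ _).
apply/(excess_gt0P xS); have [] := cycle_nbrs cc cS (mem_head _ _).
by exists (next (x :: c) x), (prev (x :: c) x).
Qed.

(** Consecutive vertices are paired. The vertex [x] ahead of the list is not matched; it lets the
    induction run on [path]. *)
Lemma matching_path (s : seq V) x : path (adj G) x s -> uniq s -> ~~ odd (size s) ->
  exists2 f, matching_fun [set t in s] f & matched_set f = [set t in s].
Proof.
have [n] := ubnP (size s); elim: n s x => // n IH [|a [|b s]] x //=.
  move=> _ _ _ _; exists [ffun x => x]; first exact: matching_fun_id.
  by apply/setP => t; rewrite !inE ffunE eqxx.
rewrite !ltnS => le /and3P[_ ab bs] /and3P[ab' bs' us]; rewrite negbK => od.
have [|f fm fE] := IH s b _ bs us od; first exact: ltnW.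
have /matching_funP[ff fS] := fm.
have fix_ t : t \notin s -> f t = t.
  by move=> ts; apply/eqP; apply: contraNT ts => ft; have [] := fS t ft; rewrite inE.
have sub : [set t in s] \subset [set t in [:: a, b & s]].
  by apply/subsetP => t; rewrite !inE => ->; rewrite !orbT.
have as' : a \notin s by move: ab'; rewrite inE negb_or => /andP[].
have [||||m _] := add_edge_matching (matching_funS sub fm) (x := a) (y := b) _ _ ab;
  rewrite ?inE ?eqxx ?orbT ?fix_ //.
exists (add_edge f a b) => //; apply/setP => t; rewrite !inE !ffunE.
have [->|ta] := eqVneq t a; first by rewrite eq_sym; move: ab'; rewrite inE negb_or => /andP[->].
have [->|tb] := eqVneq t b; first by move: ab'; rewrite inE negb_or => /andP[].
by move/setP: fE => /(_ t); rewrite !inE.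
Qed.

Lemma matching_odd_cycle c r : is_cycle G c -> odd (size c) -> r \in c ->
  exists2 f, matching_fun ([set t in c] :\ r) f & matched_set f = [set t in c] :\ r.
Proof.
move=> cc od rc.
have [i s ip] := rot_to rc; have := is_cycle_rot i c; rewrite ip cc => /and3P[_ us cyc].
have -> : [set t in c] :\ r = [set t in s].
  apply/setP => t; rewrite !inE -(mem_rot i) ip inE.
  by case: eqVneq => //= ->; apply/esym/negbTE; case/andP: us.
apply: (@matching_path s r).
- by move: cyc; rewrite (cycle_path r) /= => /andP[].
- by case/andP: us.
- by have := size_rot i c; rewrite ip /= => E; rewrite -E in od.
Qed.
End InducedSubgraphs.

(** * The contracted forest *)

Section Contraction.
Variables (V : finType) (G : sgraph V).
Hypothesis dj : disjoint_cycles G.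
Implicit Types (x y z : V) (B : block G).

Lemma mem_cycle_set C x : C \in cycle_sets G -> x \in C ->
  exists c, [/\ is_cycle G c, x \in c & C = [set t in c]].
Proof. by move=> /cycle_setsP[c cc ->]; rewrite inE => xc; exists c. Qed.

Lemma cycle_set_uniq C C' x : C \in cycle_sets G -> C' \in cycle_sets G ->
  x \in C -> x \in C' -> C = C'.
Proof.
move=> CC CC' /(mem_cycle_set CC)[c [cc xc ->]] /(mem_cycle_set CC')[c' [cc' xc' ->]].
by apply/setP => t; rewrite !inE (disjoint_cycles_mem dj cc cc' xc xc').
Qed.

Lemma block_cases B : val B \in cycle_sets G \/
  exists2 x, x \notin cover (cycle_sets G) & val B = [set x].
Proof.
have := valP B; rewrite /contraction_blocks => /setUP[|/imsetP[x]]; first by left.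
by rewrite inE => xn ->; right; exists x.
Qed.

Lemma block_mem B : exists x, x \in val B.
Proof.
case: (block_cases B) => [/cycle_setsP[[|x c] // cc ->]|[x _ ->]]; exists x.
  by rewrite inE mem_head.
by rewrite inE.
Qed.

Lemma block_uniq B B' x : x \in val B -> x \in val B' -> B = B'.
Proof.
move=> xB xB'; apply: val_inj.
case: (block_cases B) (block_cases B') => [CB|[y yB EB]] [CB'|[y' yB' EB']].
- exact: cycle_set_uniq xB xB'.
- move: xB'; rewrite EB' inE => /eqP E; case/negP: yB'; apply/bigcupP.
  by exists (val B); rewrite -?E.
- move: xB; rewrite EB inE => /eqP E; case/negP: yB; apply/bigcupP.
  by exists (val B'); rewrite -?E.
- by move: xB xB'; rewrite EB EB' !inE => /eqP <- /eqP <-.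
Qed.

Lemma block_ex x : exists B, x \in val B.
Proof.
have [/bigcupP[C CC xC]|xn] := boolP (x \in cover (cycle_sets G)).
  have CB : C \in contraction_blocks G by rewrite inE CC.
  by exists (Sub C CB); rewrite SubK.
have CB : [set x] \in contraction_blocks G.
  by rewrite inE; apply/orP; right; apply: imset_f; rewrite inE.
by exists (Sub [set x] CB); rewrite SubK inE.
Qed.

Definition block_of x : block G := xchoose (block_ex x).

Lemma mem_block_of x : x \in val (block_of x).
Proof. exact: (xchooseP (block_ex x)). Qed.

Lemma block_ofE B x : x \in val B -> block_of x = B.
Proof. by apply: block_uniq; apply: mem_block_of. Qed.

Lemma contracted_block_of x y : adj G x y -> block_of x != block_of y ->
  adj (contracted G) (block_of x) (block_of y).
Proof.
move=> xy ne; rewrite /= /contracted_adj ne; apply/exists_inP.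
exists x; first exact: mem_block_of.
by apply/exists_inP; exists y; rewrite // mem_block_of.
Qed.

Lemma contracted_adjP B B' : adj (contracted G) B B' ->
  B != B' /\ exists x y, [/\ x \in val B, y \in val B' & adj G x y].
Proof.
by case/andP=> ne /exists_inP[x xB /exists_inP[y yB' xy]]; split=> //; exists x, y.
Qed.

Lemma cycle_connect c x y z : is_cycle G c -> x \in c -> y \in c -> z \in c ->
  y != x -> z != x -> connect (sub_adj G ([set t in c] :\ x)) y z.
Proof.
move=> cc xc yc zc yx zx.
have [i s ip] := rot_to xc; have := is_cycle_rot G i c; rewrite ip cc => /and3P[_ us cyc].
have mc t : t \in c -> t != x -> t \in s.
  by move=> tc tx; move: tc; rewrite -(mem_rot i) ip inE (negPf tx).
suff H t : t \in s -> connect (sub_adj G ([set t in c] :\ x)) (head x s) t.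
  by apply: connect_trans (H z (mc z zc zx)); rewrite sub_adjC; apply: H; apply: mc.
case: s ip us cyc {mc} => [//|a s] ip us cyc ts.
case/splitPl: ts us cyc ip => p1 p2 tl us cyc ip; rewrite -tl; apply: path_connect.
  by move: cyc; rewrite (cycle_path x) /= cat_path => /and4P[_ _ -> _].
move=> w wp; have wnp : w \in a :: p1 ++ p2 by rewrite -cat_cons mem_cat wp.
rewrite in_setD1 inE -(mem_rot i) ip inE wnp orbT andbT.
by case/andP: us => nx _; apply: contraNneq nx => <-.
Qed.

Lemma block_connect B x y : x \in val B -> y \in val B ->
  connect (sub_adj G (val B)) x y.
Proof.
case: (block_cases B) => [CB|[z _ ->]]; last by rewrite !inE => /eqP -> /eqP ->.
move=> xB; have [c [cc xc CE]] := mem_cycle_set CB xB; rewrite CE inE => yc.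
have [->|yx] := eqVneq y x; first exact: connect0.
have /and3P[_ uc cyc] := cc.
have xn := next_cycle cyc xc.
have nx : next c x != x by apply: contraTneq xn => ->; rewrite adj_irr.
have nc : next c x \in c by rewrite mem_next.
apply: (@connect_trans _ _ (next c x)).
  by apply: connect1; rewrite /sub_adj !inE xc nc.
by apply: (sub_adjS (subsetDl _ [set x])); apply: cycle_connect.
Qed.

(** A walk through blocks lifts to the graph because each block is connected and distinct blocks are
    disjoint. *)
Lemma contracted_connect B B1 B2 y1 y2 :
  B1 != B -> connect (sub_adj (contracted G) (setT :\ B)) B1 B2 ->
  y1 \in val B1 -> y2 \in val B2 -> connect (sub_adj G (~: val B)) y1 y2.
Proof.
move=> B1B cB y1B y2B.
have sub B' : B' != B -> val B' \subset ~: val B.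
  move=> B'B; apply/subsetP => t tB'; rewrite inE; apply: contra B'B => tB.
  by rewrite (block_uniq tB' tB).
pose a : pred (block G) := fun B' => (B' != B) &&
    [forall y in val B', connect (sub_adj G (~: val B)) y1 y].
suff /andP[_ /forall_inP] : a B2 by apply.
apply: (@connect_stable _ _ _ a _ _ _ cB) => [B' B''|]; rewrite /a.
  case/and3P=> _; rewrite !inE andbT => B''B /contracted_adjP[_ [x [x' [xB' xB'' xx']]]].
  case/andP=> B'B /forall_inP/(_ x xB') y1x; rewrite B''B; apply/forall_inP => y yB''.
  apply: (connect_trans y1x); apply: (@connect_trans _ _ x').
    apply: connect1; rewrite /sub_adj xx' (subsetP (sub _ B'B)) //.
    by rewrite (subsetP (sub _ B''B)).
  by apply: sub_adjS (block_connect xB'' yB''); apply: sub.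
rewrite B1B; apply/forall_inP => y yB1.
by apply: sub_adjS (block_connect y1B yB1); apply: sub.
Qed.

(** A cycle of the contraction through [B] gives two edges leaving [B] whose outer ends are
    connected outside [B]. If [B] is a cycle, one of these edges contradicts being a bridge; if [B]
    is a single vertex, that vertex would lie on a cycle. *)
Lemma contracted_acyclic : cycle_rank (contracted G) setT = 0.
Proof.
apply/eqP; rewrite -leqn0 leqNgt; apply/negP => /cycle_rank_gt0[B BT].
move=> /(excess_gt0P _ BT)[B1 [B2 [B1N B2N B12 cB]]].
have adjN B' : B' \in nbrs (contracted G) setT B ->
    B' != B /\ exists x y, [/\ x \in val B, y \in val B' & adj G x y].
  by rewrite inE inE /= => /contracted_adjP[]; rewrite eq_sym.
have [B1B [x1 [y1 [x1B y1B xy1]]]] := adjN _ B1N.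
have [B2B [x2 [y2 [x2B y2B xy2]]]] := adjN _ B2N.
have cy := contracted_connect B1B cB y1B y2B.
have y12 : y2 != y1.
  by apply: contraNneq B12 => y21; rewrite y21 in y2B; rewrite (block_uniq y1B y2B).
have notB B' y : B' != B -> y \in val B' -> y \notin val B.
  by move=> B'B yB'; apply: contra B'B => yB; rewrite (block_uniq yB' yB).
have sub t : t \in val B -> ~: val B \subset setT :\ t.
  move=> tB; apply/subsetP => w; rewrite !inE andbT.
  by apply: contraNneq => ->.
case: (block_cases B) => [CB|[x xn EB]].
  have [c [cc xc CE]] := mem_cycle_set CB x1B.
  have y1c : y1 \notin c by have := notB _ _ B1B y1B; rewrite CE inE.
  have x2c : x2 \in c by move: x2B; rewrite CE inE.
  suff [w [xw wy cw]] : exists w,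
      [/\ adj G x1 w, w != y1 & connect (sub_adj G (setT :\ x1)) w y1].
    by have := disjoint_cycles_bridge dj cc xc y1c xw xy1 wy; rewrite cw.
  have cy' := sub_adjS (sub _ x1B) cy.
  (* If the two edges leave [B] at different vertices, the connection is completed around the cycle
     from [x2] to the successor of [x1], avoiding [x1]. *)
  have [x21|x21] := eqVneq x2 x1.
    by exists y2; rewrite -{1}x21 sub_adjC.
  have /and3P[_ uc cyc] := cc; have xnx := next_cycle cyc xc.
  have nc : next c x1 \in c by rewrite mem_next.
  exists (next c x1); split=> //; first by apply: contraNneq y1c => <-.
  rewrite sub_adjC; apply: connect_trans cy' _; apply: (@connect_trans _ _ x2).
    apply: connect1; rewrite /sub_adj adj_sym xy2 !inE x21 !andbT.
    by apply: contraNneq (notB _ _ B2B y2B) => ->.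
  apply: (sub_adjS (setSD _ (subsetT [set t in c]))); apply: cycle_connect => //.
  by apply: contraTneq xnx => ->; rewrite adj_irr.
move: x1B x2B (sub x); rewrite EB !inE => /eqP E1 /eqP E2 sx; subst x1 x2.
have N y : adj G x y -> y \in nbrs G setT x by rewrite !inE.
have y12' : y1 != y2 by rewrite eq_sym.
rewrite EB in cy; have cyx := sub_adjS (sx (eqxx x)) cy.
have [c [cc _ xc _ _]] := cycle_through (in_setT x) (N _ xy1) (N _ xy2) y12' cyx.
case/negP: xn; apply/bigcupP; exists [set t in c]; last by rewrite inE.
by apply/cycle_setsP; exists c.
Qed.

(** * Matchings of the graph and of its contraction *)

Lemma card_unmatched (T : finType) (f : {ffun T -> T}) :
  #|[set x | f x == x]| + #|matched_set f| = #|T|.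
Proof.
rewrite -(cardsC (matched_set f)) addnC; congr (_ + _).
by apply: eq_card => x; rewrite !inE negbK.
Qed.

Definition odd_cycles := forall c, is_cycle G c -> odd (size c).

Lemma odd_cycle_set C : odd_cycles -> C \in cycle_sets G -> odd #|C|.
Proof.
move=> od /cycle_setsP[c cc ->]; rewrite cardsE.
by have /and3P[_ /card_uniqP -> _] := cc; apply: od.
Qed.

(* A matching of the contracted graph, plus a near-perfect matching of each cycle
   that avoids the vertex through which that cycle is matched. *)
Lemma lift_matching (nu : {ffun block G -> block G}) : odd_cycles ->
  matching_fun (contracted G) setT nu ->
  #|V| + #|matched_set nu| <= max_matched G setT + #|block G|.
Proof.
move=> od /matching_funP[nn nS].
have [g gP] : exists g : block G * block G -> V * V, forall p, adj (contracted G) p.1 p.2 ->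
    [/\ (g p).1 \in val p.1, (g p).2 \in val p.2 & adj G (g p).1 (g p).2].
  apply: (@fin_all_exists _ _ (fun p q => adj (contracted G) p.1 p.2 ->
    [/\ q.1 \in val p.1, q.2 \in val p.2 & adj G q.1 q.2])) => -[B B'].
  have [/contracted_adjP[_ [x [y xy]]]|] := boolP (adj (contracted G) B B').
    by exists (x, y).
  by have [x0 _] := block_mem B; move=> n; exists (x0, x0) => /= BB'; case/negP: n.
(* The choice [g] is made for ordered pairs; comparing ranks makes [e B B'] and [e B' B] the two
   ends of the same edge. *)
pose e B B' := if enum_rank B < enum_rank B' then (g (B, B')).1 else (g (B', B)).2.
have eP B B' : adj (contracted G) B B' -> e B B' \in val B /\ adj G (e B B') (e B' B).
  move=> BB'; have B'B : adj (contracted G) B' B by rewrite adj_sym.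
  have ne : B != B' by apply: contraTneq BB' => ->; rewrite adj_irr.
  have [g1 g2 g3] := gP (B, B') BB'; have [h1 h2 h3] := gP (B', B) B'B.
  rewrite /e; case: ltngtP => [lt|lt|E] //=; first by rewrite adj_sym.
  by case/eqP: ne; apply/enum_rank_inj/val_inj.
have [r rP] : exists r : block G -> V, forall B, r B \in val B /\
    (nu B != B -> adj G (r B) (e (nu B) B) /\ r B = e B (nu B)).
  apply: (@fin_all_exists _ _ (fun B rB => rB \in val B /\
    (nu B != B -> adj G rB (e (nu B) B) /\ rB = e B (nu B)))) => B.
  have [E|nB] := eqVneq (nu B) B; first by have [x xB] := block_mem B; exists x.
  by have [_ /eP[e1 e2]] := nS B nB; exists (e B (nu B)).
have [h hP] : exists h : block G -> {ffun V -> V}, forall B,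
    matching_fun G (val B :\ r B) (h B) /\ matched_set (h B) = val B :\ r B.
  apply: (@fin_all_exists _ _ (fun B hB =>
    matching_fun G (val B :\ r B) hB /\ matched_set hB = val B :\ r B)) => B.
  have [rB _] := rP B.
  case: (block_cases B) => [CB|[x _ EB]].
    have [c [cc rc CE]] := mem_cycle_set CB rB; rewrite CE.
    by have [f] := matching_odd_cycle cc (od c cc) rc; exists f.
  have -> : val B :\ r B = set0.
    by apply/setP => t; move: rB; rewrite EB !inE => /eqP ->; rewrite andNb.
  exists [ffun x => x]; split; first exact: matching_fun_id.
  by apply/setP => t; rewrite !inE ffunE eqxx.
have rb B : block_of (r B) = B by apply: block_ofE; case: (rP B).
pose mu : {ffun V -> V} := [ffun x => if x == r (block_of x)
  then if nu (block_of x) == block_of x then x else r (nu (block_of x))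
  else h (block_of x) x].
have muE B x : x \in val B ->
    mu x = if x == r B then if nu B == B then x else r (nu B) else h B x.
  by move=> /block_ofE <-; rewrite ffunE.
have hM B x : x \in val B -> x != r B ->
    [/\ h B x \in val B, h B x != r B, h B x != x, h B (h B x) = x & adj G x (h B x)].
  move=> xB xr; have [hm hE] := hP B; have /matching_funP[hh hS] := hm.
  have hx : h B x != x by move/setP: hE => /(_ x); rewrite !inE xB xr => ->.
  have [_ xhx] := hS x hx.
  have hhx : h B (h B x) != h B x by rewrite hh eq_sym.
  by have [+ _] := hS _ hhx; rewrite !inE => /andP[h1 h2].
have muP : matching_fun G setT mu.
  apply/matching_funP; split=> x; have xB := mem_block_of x;
    rewrite (muE _ _ xB); set B := block_of x in xB *; last first.
    rewrite in_setT; case: (eqVneq x (r B)) => [xr|xr].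
      case: (eqVneq (nu B) B) => [_|nB _]; first by rewrite eqxx.
      rewrite xr; have [_ /(_ nB)[_ rE]] := rP B; rewrite rE.
      have [_ /eP[_]] := nS B nB; split=> //.
      by have [_] := rP (nu B); rewrite nn eq_sym => /(_ nB)[_ ->].
    by have [] := hM B x xB xr.
  case: (eqVneq x (r B)) => [xr|xr].
    case: (eqVneq (nu B) B) => [nB|nB]; first by rewrite (muE _ _ xB) {1}xr eqxx nB eqxx.
    have [rB _] := rP (nu B).
    by rewrite (muE _ _ rB) eqxx nn eq_sym (negPf nB).
  have [h1 h2 h3 h4 _] := hM B x xB xr.
  by rewrite (muE _ _ h1) (negPf h2).
(* A vertex missed by [mu] is the representative [r B] of a block missed by [nu]; the claim is this
   inequality after complementation. *)
have le : #|[set x | mu x == x]| <= #|[set B | nu B == B]|.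
  rewrite -(card_in_imset (f := r) (D := [set B | nu B == B])); last first.
    by move=> B B' _ _ E; rewrite -(rb B) E rb.
  apply/subset_leq_card/subsetP => x; have xB := mem_block_of x.
  rewrite inE (muE _ _ xB); set B := block_of x in xB *.
  case: (eqVneq x (r B)) => [xr|xr].
    case: (eqVneq (nu B) B) => [nB _|nB /eqP E].
      by rewrite xr; apply: imset_f; rewrite inE nB.
    by case/eqP: nB; rewrite -(rb (nu B)) E.
  by have [_ _ /negPf ->] := hM B x xB xr.
rewrite -(card_unmatched mu) -(card_unmatched nu) [X in _ <= X]addnA leq_add2r addnC.
by apply: leq_add => //; apply: max_matchedP.
Qed.

(** Condition (iii) for an involution: no matched pair has exactly one end on a cycle. *)
Definition cycle_preserving (f : V -> V) :=
  forall C x, C \in cycle_sets G -> x \in C -> f x \in C.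

Definition noncyclic : {set V} := ~: cover (cycle_sets G).

Lemma noncyclicP x : x \in noncyclic -> val (block_of x) = [set x].
Proof.
rewrite inE => xn; case: (block_cases (block_of x)) => [CB|[y _ E]].
  by case/negP: xn; apply/bigcupP; exists (val (block_of x)); rewrite ?mem_block_of.
by have := mem_block_of x; rewrite E inE => /eqP ->.
Qed.

(** An odd cycle preserved by [f] contains a fixed point of [f]. Hence every block contains a vertex
    missed by [f] or is a matched vertex off the cycles, which bounds the number of blocks. *)
Lemma restrict_noncyclic f : odd_cycles -> matching_fun G setT f -> cycle_preserving f ->
  exists2 g, matching_fun G noncyclic g &
    #|matched_set f| + #|block G| <= #|V| + #|matched_set g|.
Proof.
move=> od fm fC; have /matching_funP[ff fS] := fm.
pose g : {ffun V -> V} := [ffun x => if x \in noncyclic then f x else x].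
have fW x : x \in noncyclic -> f x \in noncyclic.
  rewrite !inE; apply: contra => /bigcupP[C CC fxC]; apply/bigcupP; exists C => //.
  by rewrite -(ff x); apply: fC.
exists g.
  apply/matching_funP; split=> x; rewrite !ffunE.
    by case: (boolP (x \in noncyclic)) => [/fW ->|/negPf ->//]; rewrite ff.
  by case: ifP => [xW /fS[_ ->]|]; rewrite ?eqxx.
rewrite -(card_unmatched f) -[X in _ <= X]addnA [X in _ <= X]addnCA leq_add2l.
have sub : [set: block G] \subset
    [set block_of x | x in [set x | f x == x]] :|: [set block_of x | x in matched_set g].
  apply/subsetP => B _; rewrite in_setU.
  case: (block_cases B) => [CB|[x xn EB]].
    apply/orP; left; have : [exists x in val B, f x == x].
      apply: contraT; rewrite negb_exists_in => /forall_inP H.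
      have : ~~ odd #|val B| by apply: (invol_even ff) => x xB; rewrite (H x xB) (fC _ _ CB xB).
      by rewrite odd_cycle_set.
    case/exists_inP=> x xB fx; apply/imsetP; exists x; first by rewrite inE.
    by rewrite (block_ofE xB).
  have xB : x \in val B by rewrite EB inE.
  have [fx|fx] := eqVneq (f x) x; apply/orP; [left|right]; apply/imsetP; exists x;
    rewrite ?(block_ofE xB) // inE ?fx //.
  by rewrite ffunE inE xn.
have := subset_leq_card sub; rewrite cardsT => le; apply: leq_trans le _.
apply: leq_trans (leq_card_setU _ _) _.
by apply: leq_add; apply: leq_imset_card.
Qed.

Definition cycle_cover (A : {set V}) := forall x y, adj G x y ->
  [\/ x \in A, y \in A | exists C, [/\ C \in cycle_sets G, x \in C & y \in C]].

(** Weak duality. A block without a vertex missed by [f] has, by parity, a vertex matched to the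
    outside; that edge is covered by [A], so the block meets [A] or its image. *)
Lemma matched_cycle_cover f A : odd_cycles -> matching_fun G setT f -> cycle_cover A ->
  #|matched_set f| + #|block G| <= #|V| + 2 * #|A|.
Proof.
move=> od /matching_funP[ff fS] cA;
rewrite -(card_unmatched f) -[X in _ <= X]addnA [X in _ <= X]addnCA leq_add2l.
have sub : [set: block G] \subset
    [set block_of x | x in [set x | f x == x]] :|: [set block_of x | x in A :|: f @: A].
  apply/subsetP => B _; rewrite in_setU.
  have [/exists_inP[x xB fx]|] := boolP [exists x in val B, f x == x].
    apply/orP; left; apply/imsetP; exists x; first by rewrite inE.
    by rewrite (block_ofE xB).
  rewrite negb_exists_in => /forall_inP H; apply/orP; right.
  suff [x xB fxB] : exists2 x, x \in val B & f x \notin val B.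
    have [_ xfx] := fS x (H x xB).
    apply/imsetP; exists x; last by rewrite (block_ofE xB).
    rewrite inE; case: (cA _ _ xfx) => [-> //|fxA|[C [CC xC fxC]]].
      by apply/orP; right; rewrite -(ff x); apply: imset_f.
    case/negP: fxB; have CB : C \in contraction_blocks G by rewrite inE CC.
    have xC' : x \in val (Sub C CB : block G) by rewrite SubK.
    by rewrite (block_uniq xB xC') SubK.
  apply/exists_inP; apply: contraT; rewrite negb_exists_in => /forall_inP H2.
  have fB x : x \in val B -> f x \in val B by move=> /H2; rewrite negbK.
  case: (block_cases B) => [CB|[x xn EB]].
    have : ~~ odd #|val B| by apply: (invol_even ff) => x xB; rewrite (H x xB) fB.
    by rewrite odd_cycle_set.
  have xB : x \in val B by rewrite EB inE.
  by have := fB x xB; rewrite {1}EB inE (negPf (H x xB)).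
have := subset_leq_card sub; rewrite cardsT => le; apply: leq_trans le _.
apply: leq_trans (leq_card_setU _ _) _.
apply: leq_add; first exact: leq_imset_card.
apply: leq_trans (leq_imset_card _ _) _; apply: leq_trans (leq_card_setU _ _) _.
by rewrite mul2n -addnn leq_add2l leq_imset_card.
Qed.

Lemma transfer_matching (U : finType) (GU : sgraph U) (phi : U -> V) (S : {set V}) h :
  injective phi -> (forall u, phi u \in S) ->
  (forall u u', adj GU u u' -> adj G (phi u) (phi u')) -> matching_fun GU setT h ->
  exists2 g, matching_fun G S g & #|matched_set g| = #|matched_set h|.
Proof.
move=> inj phiS hom /matching_funP[hh hS].
pose g : {ffun V -> V} := [ffun x => if [pick u | phi u == x] is Some u then phi (h u) else x].
have gE u : g (phi u) = phi (h u).
  rewrite ffunE; case: pickP => [u' /eqP/inj -> //|/(_ u)]; by rewrite eqxx.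
have gN x : g x = x \/ exists u, x = phi u.
  rewrite ffunE; case: pickP => [u /eqP <-|_]; last by left.
  by right; exists u.
exists g.
  apply/matching_funP; split=> x; case: (gN x) => [E|[u ->]].
  - by rewrite !E.
  - by rewrite !gE hh.
  - by rewrite E eqxx.
  - by rewrite gE phiS (inj_eq inj) => /hS[_ /hom].
rewrite -(card_imset _ inj); apply: eq_card => x; rewrite inE.
apply/idP/imsetP => [gx|[u + ->]]; last by rewrite inE gE (inj_eq inj).
case: (gN x) gx => [->|[u ->]]; first by rewrite eqxx.
by rewrite gE (inj_eq inj) => hu; exists u; rewrite ?inE.
Qed.

Lemma contracted_noncyclic_matching : exists2 g, matching_fun G noncyclic g &
  #|matched_set g| = 2 * matching_number (contracted_noncyclic G).
Proof.
pose U : finType := {B : block G | B \in noncyclic_blocks G}.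
have [h hm hE] := max_matched_ex (contracted_noncyclic G) setT.
have [phi phiP] : exists phi : U -> V, forall u, val (val u) = [set phi u] /\ phi u \in noncyclic.
  apply: (@fin_all_exists _ _ (fun u x => val (val u) = [set x] /\ x \in noncyclic)) => u.
  have := valP u; rewrite inE; case: (block_cases (val u)) => [->//|[x xn ->] _].
  by exists x; rewrite inE.
have [||u u'|g gm gE] := @transfer_matching _ (contracted_noncyclic G) phi noncyclic h _ _ _ hm.
- move=> u u' E; apply/val_inj/val_inj.
  by have [-> _] := phiP u; have [-> _] := phiP u'; rewrite E.
- by move=> u; have [] := phiP u.
- move=> /contracted_adjP[_ [x [y []]]]; have [-> _] := phiP u; have [-> _] := phiP u'.
  by rewrite !inE => /eqP -> /eqP ->.
by exists g => //; rewrite gE hE max_matched_number.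
Qed.

Lemma block_of_noncyclic_inj : {in noncyclic &, injective block_of}.
Proof.
move=> x y xW yW E; have := noncyclicP xW.
by rewrite E (noncyclicP yW) => /setP/(_ x); rewrite !inE eqxx => /eqP ->.
Qed.

(** The members of [AT] off the cycles already cover all edges off the cycles, so |g| <= 2 |A| <= 2
    |AT| <= |g|. Equality throughout means that [AT] contains no contracted cycle and can be pulled
    back to vertices. *)
Lemma cycle_cover_of_contracted (AT : {set block G}) g :
  vertex_cover (contracted G) setT AT -> matching_fun G noncyclic g ->
  2 * #|AT| <= #|matched_set g| ->
  exists A : {set V}, [/\ A \subset noncyclic, cycle_cover A, #|A| = #|AT|
                        & #|matched_set g| = 2 * #|A|].
Proof.
move=> /vertex_coverP cAT gm le.
pose A := [set x in noncyclic | block_of x \in AT].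
have AW : A \subset noncyclic by apply/subsetP => x; rewrite inE => /andP[].
have cAE x y : adj G x y -> block_of x != block_of y ->
    (block_of x \in AT) || (block_of y \in AT).
  by move=> xy ne; apply: cAT; rewrite ?inE // contracted_block_of.
have vA : vertex_cover G noncyclic A.
  apply/vertex_coverP => x y xW yW xy; rewrite [x \in A]inE [y \in A]inE xW yW; apply: cAE => //.
  by apply: contraTneq xy => /(block_of_noncyclic_inj xW yW) ->; rewrite adj_irr.
have le2 := matched_cover gm vA.
have sub : block_of @: A \subset AT.
  by apply/subsetP => B /imsetP[x]; rewrite inE => /andP[_ ?] ->.
have cardA : #|block_of @: A| = #|A|.
  by apply: card_in_imset => x y /(subsetP AW) xW /(subsetP AW) yW; apply: block_of_noncyclic_inj.
have leA : #|A| <= #|AT| by rewrite -cardA subset_leq_card.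
have AE : #|A| = #|AT|.
  by apply/eqP; rewrite eqn_leq leA -(leq_pmul2l (m := 2)) // (leq_trans le le2).
have imE : block_of @: A = AT.
  by apply/eqP; rewrite eqEcard sub cardA AE leqnn.
have inA x : block_of x \in AT -> x \in A.
  rewrite -imE => /imsetP[y yA E]; have yW := subsetP AW y yA.
  by have := mem_block_of x; rewrite E (noncyclicP yW) inE => /eqP ->.
exists A; split=> //; last by apply/eqP; rewrite eqn_leq le2 AE.
move=> x y xy; have [E|ne] := eqVneq (block_of x) (block_of y).
  constructor 3; exists (val (block_of x)).
  have yB : y \in val (block_of x) by rewrite E mem_block_of.
  split; rewrite ?mem_block_of //; case: (block_cases (block_of x)) => // -[z _ EB].
  have := mem_block_of x; move: yB xy; rewrite EB !inE => /eqP yz + /eqP xz.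
  by rewrite yz xz adj_irr.
by case/orP: (cAE x y xy ne) => /inA ?; [constructor 1 | constructor 2].
Qed.

(** Conditions (iii) and (iv) serve the same purpose: each yields a matching off the cycles as large
    as a maximum matching of the contraction. The last equation then holds by [lift_matching] and
    weak duality. *)
Lemma cycle_cover_certificate : odd_cycles ->
  (exists f, [/\ matching_fun G setT f, #|matched_set f| = max_matched G setT
               & cycle_preserving f])
  \/ matching_number (contracted G) = matching_number (contracted_noncyclic G) ->
  exists (A : {set V}) g, [/\ A \subset noncyclic, cycle_cover A,
    matching_fun G noncyclic g, #|matched_set g| = 2 * #|A|
    & max_matched G setT + #|block G| = #|V| + 2 * #|A|].
Proof.
move=> od H; have [AT [nu [_ cAT num nuE]]] := koenig_forest contracted_acyclic.
have lift := lift_matching od num.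
have [g gm gE] : exists2 g, matching_fun G noncyclic g & 2 * #|AT| <= #|matched_set g|.
  case: H => [[f [fm fmax fC]]|E].
    have [g gm gE] := restrict_noncyclic od fm fC; exists g => //.
    by rewrite -(leq_add2l #|V|) -nuE; apply: leq_trans lift _; rewrite -fmax.
  have [g gm gE] := contracted_noncyclic_matching; exists g => //.
  by rewrite gE -E -max_matched_number -nuE max_matchedP.
have [A [AW cA AE gA]] := cycle_cover_of_contracted cAT gm gE.
exists A, g; split=> //; apply/eqP; rewrite eqn_leq; apply/andP; split.
  by have [f fm <-] := max_matched_ex G setT; apply: matched_cycle_cover.
by rewrite AE -nuE.
Qed.

Lemma card_blocks : #|V| + #|cycle_sets G| = \sum_(C in cycle_sets G) #|C| + #|block G|.
Proof.
have tI : trivIset (cycle_sets G).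
  apply/trivIsetP => C C' CC CC'; apply: contraR => /pred0Pn[x /andP[/= xC xC']].
  by apply/eqP; apply: cycle_set_uniq xC xC'.
rewrite (eqP tI) card_sig.
have -> : #|[pred B | B \in contraction_blocks G]| = #|contraction_blocks G| by apply: eq_card.
rewrite /contraction_blocks cardsU disjoint_setI0; last first.
  apply/pred0P => C /=; apply/negP => /andP[CC /imsetP[x]].
  rewrite inE => xn E; case/negP: xn; apply/bigcupP; exists C => //.
  by rewrite E inE.
rewrite cards0 subn0 card_imset; last exact: set1_inj.
by rewrite [RHS]addnCA cardsC addnC.
Qed.

Lemma cycle_preserving_matching :
  (exists M : {set {set V}}, is_max_matching G M /\ M :&: cycle_boundary_edges G = set0)
  <-> (exists f, [/\ matching_fun G setT f, #|matched_set f| = max_matched G setT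
               & cycle_preserving f]).
Proof.
split.
  case=> M [/andP[mM /eqP maxM] MF]; have [f [fm fE fM]] := matching_fun_of mM.
  have /matching_funP[ff fS] := fm.
  exists f; split=> //; first by rewrite fE maxM max_matched_number.
  move=> C x CC xC; have [->//|fx] := eqVneq (f x) x.
  apply: contraT => fxC; have /setP/(_ [set x; f x]) := MF.
  rewrite in_set0 in_setI fM //= inE => /negP[]; apply/andP; split.
    apply/imsetP; exists (x, f x) => //; rewrite inE /=.
    by have [] := fS x fx.
  apply/exists_inP; exists C => //.
  have -> : [set x; f x] :&: C = [set x].
    apply/setP => t; rewrite !inE; have [->|tx] := eqVneq t x; first by rewrite xC.
    by have [->|//] := eqVneq t (f x); rewrite (negPf fxC).
  by rewrite cards1.
case=> f [fm fmax fC]; have [mE cE] := edges_of_matching fm.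
have /matching_funP[ff fS] := fm.
exists (edges_of f); split.
  rewrite /is_max_matching mE -(eqn_pmul2l (m := 2)) // -cE fmax.
  by rewrite max_matched_number eqxx.
apply/setP => e; rewrite in_set0 in_setI; apply/negbTE; apply/negP => /andP[].
case/imsetP=> x; rewrite inE => fx ->; rewrite inE => /andP[_ /exists_inP[C CC]].
have E : (f x \in C) = (x \in C).
  by apply/idP/idP => [/(fC _ _ CC)|/(fC _ _ CC)//]; rewrite ff.
have [xC|xC] := boolP (x \in C).
  have -> : [set x; f x] :&: C = [set x; f x].
    by apply/setIidPl/subsetP => t /set2P[] ->; rewrite ?E.
  by rewrite cards2 [x == _]eq_sym fx.
have -> : [set x; f x] :&: C = set0; last by rewrite cards0.
apply/setP => t; rewrite in_set0 in_setI; apply/negP => /andP[/set2P[] ->];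
  by rewrite ?E; apply/negP.
Qed.
End Contraction.

Import Order.TTheory GRing.Theory Num.Theory.

(** * Negative inertia of Hermitian matrices *)

Section NegativeInertia.
Variable C : numClosedFieldType.
Local Open Scope ring_scope.
Local Open Scope sesquilinear_scope.

Definition neg_index n (H : 'M[C]_n) : nat :=
  count (fun a : C => a < 0) (eigenvalues H).

Definition qform n (H : 'M[C]_n) (u v : 'rV[C]_n) : C :=
  (u *m H *m v ^t*) 0 0.

Definition negdef n m (H : 'M[C]_n) (U : 'M[C]_(m, n)) : Prop :=
  forall v : 'rV_n, (v <= U)%MS -> v != 0 -> qform H v v < 0.

Lemma char_poly_conj n (P A : 'M[C]_n) :
  P \in unitmx -> char_poly (invmx P *m A *m P) = char_poly A.
Proof.
move=> Pu; rewrite /char_poly.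
have -> : char_poly_mx (invmx P *m A *m P)
   = map_mx (@polyC C) (invmx P) *m char_poly_mx A *m map_mx (@polyC C) P.
  rewrite /char_poly_mx !map_mxM /= mulmxBr mulmxBl; congr (_ - _).
  rewrite mul_mx_scalar -scalemxAl -map_mxM /= mulVmx // map_mx1.
  by rewrite scalemx1.
rewrite !det_mulmx mulrAC -det_mulmx -map_mxM /= mulVmx // map_mx1 det1.
by rewrite mul1r.
Qed.

Lemma eigenvalues_conj_diag n (P : 'M[C]_n) (d : 'rV[C]_n) :
  P \in unitmx ->
  perm_eq (eigenvalues (invmx P *m diag_mx d *m P))
          [seq d 0 i | i <- enum 'I_n].
Proof.
move=> Pu; rewrite /eigenvalues; case: closed_field_poly_normal => r /= rE.
apply/prod_XsubC_eq.
move: rE; rewrite (monicP (char_poly_monic _)) scale1r => <-.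
rewrite char_poly_conj // char_poly_trig; last exact: diag_mx_is_trig.
rewrite big_map big_enum /=; apply: eq_bigr => i _.
by rewrite !mxE eqxx.
Qed.

(** Identifies the roots of the characteristic polynomial with the diagonal entries of the spectral
    theorem, up to order. *)
Lemma spectral_decomposition n (H : 'M[C]_n) : H^t* = H ->
  exists (P : 'M[C]_n) (d : 'rV[C]_n),
   [/\ P \is unitarymx, forall i, d 0 i \is Num.real,
       P *m H *m P^t* = diag_mx d
     & neg_index H = #|[set i | d 0 i < 0]|].
Proof.
move=> Hh; have Hherm : H \is hermsymmx.
  by apply/is_hermitianmxP; rewrite expr0 scale1r Hh.
have /orthomx_spectralP HE := hermitian_normalmx Hherm.
have Pu := spectral_unitarymx H; have Pun := spectral_unit H.
exists (spectralmx H), (spectral_diag H); split=> //.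
- by move=> i; apply: (mxOverP (hermitian_spectral_diag_real Hherm)).
- rewrite {2}HE !mulmxA mulmxV // mul1mx -mulmxA.
  by rewrite (unitarymxP Pu) mulmx1.
- rewrite /neg_index {1}HE (permP (eigenvalues_conj_diag _ Pun)) count_map.
  rewrite cardE -size_filter [enum [set i | _]]/enum_mem; congr size.
  rewrite -enumT; by apply: eq_filter => i; rewrite /= inE.
Qed.

Lemma unitary_rowsub n (P : 'M[C]_n) (I : {set 'I_n}) :
  P \is unitarymx -> rowsub (fun k : 'I_#|I| => enum_val k) P \is unitarymx.
Proof.
move=> /unitarymxP PP; apply/unitarymxP/matrixP => i j.
move/matrixP: PP => /(_ (enum_val i) (enum_val j)).
rewrite !mxE (inj_eq enum_val_inj) => <-; apply: eq_bigr => k _.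
by rewrite !mxE.
Qed.

Lemma qform_rowsub_diag n (H P : 'M[C]_n) (d : 'rV[C]_n) (I : {set 'I_n})
    (w : 'rV_#|I|) :
  P *m H *m P^t* = diag_mx d ->
  qform H (w *m rowsub (fun k : 'I_#|I| => enum_val k) P)
    (w *m rowsub (fun k : 'I_#|I| => enum_val k) P)
  = \sum_k d 0 (enum_val k) * `|w 0 k| ^+ 2.
Proof.
move=> PH; set U := rowsub _ P.
have UHU : U *m H *m U^t* = diag_mx (\row_k d 0 (enum_val k)).
  have -> : U *m H *m U^t* = mxsub (fun k : 'I_#|I| => enum_val k)
      (fun k : 'I_#|I| => enum_val k) (P *m H *m P^t*).
    apply/matrixP=> i j; rewrite !mxE; apply: eq_bigr => k _.
    by rewrite !mxE; congr (_ * _); apply: eq_bigr => l _; rewrite !mxE.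
  rewrite PH; apply/matrixP => i j.
  by rewrite !mxE (inj_eq enum_val_inj).
rewrite /qform trmx_mul map_mxM !mulmxA -[w *m U *m H]mulmxA.
rewrite -[_ *m _ *m U^t*]mulmxA UHU.
rewrite mxE; apply: eq_bigr => k _; rewrite mul_mx_diag !mxE.
by rewrite normCK mulrAC mulrC.
Qed.

Lemma exists_negdef n (H : 'M[C]_n) : H^t* = H ->
  exists2 U : 'M[C]_(neg_index H, n), negdef H U & \rank U = neg_index H.
Proof.
move=> /spectral_decomposition[P [d [Pu dR PHP ->]]].
have Uu := unitary_rowsub [set i | d 0 i < 0] Pu.
exists (rowsub (fun k : 'I_#|[set i | d 0 i < 0]| => enum_val k) P);
  last exact: mxrank_unitary.
move=> v /submxP[w ->]; apply: contraNT.
rewrite (qform_rowsub_diag _ PHP) real_ltNge ?real0 ?sum_real //; last first.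
  by move=> k _; rewrite realM ?rpredX ?normr_real.
rewrite negbK => S0.
have S1 k : true -> 0 <= - (d 0 (enum_val k) * `|w 0 k| ^+ 2).
  move=> _; rewrite -mulNr mulr_ge0 ?exprn_ge0 ?normr_ge0 // oppr_ge0.
  by have := enum_valP k; rewrite inE => /ltW.
have : \sum_k - (d 0 (enum_val k) * `|w 0 k| ^+ 2) == 0.
  by rewrite eq_le sumr_ge0 // andbT sumrN oppr_le0.
rewrite psumr_eq0 // => /allP wE.
suff -> : w = 0 by rewrite mul0mx.
apply/rowP => k; rewrite [RHS]mxE; apply/eqP.
have := wE k (mem_index_enum k); rewrite oppr_eq0 mulf_eq0 expf_eq0 /= normr_eq0.
by have := enum_valP k; rewrite inE => /lt_eqF ->.
Qed.

Lemma exists_nonneg n (H : 'M[C]_n) : H^t* = H ->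
  exists m, exists2 U : 'M[C]_(m, n),
     (forall v, (v <= U)%MS -> 0 <= qform H v v) & (\rank U + neg_index H = n)%N.
Proof.
move=> /spectral_decomposition[P [d [Pu dR PHP ->]]].
have Uu := unitary_rowsub (~: [set i | d 0 i < 0]) Pu.
exists #|~: [set i | d 0 i < 0]|.
exists (rowsub (fun k : 'I_#|~: [set i | d 0 i < 0]| => enum_val k) P).
  move=> v /submxP[w ->]; rewrite (qform_rowsub_diag _ PHP).
  apply: sumr_ge0 => k _; rewrite mulr_ge0 ?exprn_ge0 //.
  by have := enum_valP k; rewrite !inE -real_leNgt ?real0.
by rewrite mxrank_unitary // addnC cardsC card_ord.
Qed.

Lemma negdef_nonneg_rank n m1 m2 (H : 'M[C]_n) (U : 'M[C]_(m1, n))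
    (N : 'M[C]_(m2, n)) :
  negdef H U -> (forall v, (v <= N)%MS -> 0 <= qform H v v) ->
  (\rank U + \rank N <= n)%N.
Proof.
move=> Un Np; rewrite -mxrank_sum_cap.
suff -> : (U :&: N)%MS = 0 by rewrite mxrank0 addn0 rank_leq_col.
apply/eqP; apply: contraT => /rowV0Pn[v]; rewrite sub_capmx => /andP[vU vN] v0.
by have := lt_le_trans (Un v vU v0) (Np v vN); rewrite ltxx.
Qed.

(** Together with [exists_negdef], this makes the negative index the largest dimension of a negative
    definite subspace. *)
Lemma negdef_rank n m (H : 'M[C]_n) (U : 'M[C]_(m, n)) :
  H^t* = H -> negdef H U -> (\rank U <= neg_index H)%N.
Proof.
move=> /exists_nonneg[k [N Np rN]] Un.
by have := negdef_nonneg_rank Un Np; rewrite -[X in (_ <= X)%N]rN addnC leq_add2l.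
Qed.

Lemma hermitian_congr n (H Q : 'M[C]_n) : H^t* = H -> (Q *m H *m Q^t*)^t* = Q *m H *m Q^t*.
Proof. by move=> hH; rewrite !trmx_mul !map_mxM trmxCK hH mulmxA. Qed.

Lemma qform_congr n (H Q : 'M[C]_n) u v :
  qform (Q *m H *m Q^t*) u v = qform H (u *m Q) (v *m Q).
Proof. by rewrite /qform trmx_mul map_mxM !mulmxA. Qed.

(** The matrix [Q] may be singular: the pulled back form vanishes on its kernel, which therefore
    meets a negative definite subspace only in 0. This is half of Sylvester's law of inertia. *)
Lemma negdef_congr n m (H Q : 'M[C]_n) (U : 'M[C]_(m, n)) :
  negdef (Q *m H *m Q^t*) U ->
  negdef H (U *m Q) /\ \rank (U *m Q) = \rank U.
Proof.
move=> Un; split.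
  move=> v /submxP[w ->]; rewrite mulmxA => wUQ.
  have wU0 : w *m U != 0.
    by apply: contraNneq wUQ => ->; rewrite mul0mx.
  by rewrite -qform_congr Un // submxMl.
rewrite -(mxrank_mul_ker U Q).
suff -> : (U :&: kermx Q)%MS = 0 by rewrite mxrank0 addn0.
apply/eqP; apply: contraT => /rowV0Pn[v]; rewrite sub_capmx => /andP[vU /sub_kermxP vQ] v0.
have := Un v vU v0; rewrite qform_congr vQ /qform mul0mx mul0mx mxE.
by rewrite ltxx.
Qed.

Lemma neg_index_congr n (H Q : 'M[C]_n) : H^t* = H ->
  (neg_index (Q *m H *m Q^t*) <= neg_index H)%N.
Proof.
move=> hH; have [U Un <-] := exists_negdef (hermitian_congr Q hH).
by have [UQn <-] := negdef_congr Un; apply: negdef_rank.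
Qed.

(** The kernel of [M] has codimension at most [r], so a negative definite subspace loses at most [r]
    dimensions when intersected with it. *)
Lemma neg_index_ker n r (H1 H2 : 'M[C]_n) (M : 'M[C]_(n, r)) :
  H1^t* = H1 -> H2^t* = H2 ->
  (forall v : 'rV_n, v *m M = 0 -> qform H1 v v = qform H2 v v) ->
  (neg_index H1 <= r + neg_index H2)%N.
Proof.
move=> h1 h2 H12; have [U Un <-] := exists_negdef h1.
have : negdef H2 (U :&: kermx M)%MS.
  move=> v; rewrite sub_capmx => /andP[vU /sub_kermxP vM] v0.
  by rewrite -H12 // Un.
move/(negdef_rank h2) => le2.
have : (\rank U <= r + \rank (U :&: kermx M))%N.
  by rewrite -(mxrank_mul_ker U M) leq_add2r rank_leq_col.
by move=> le1; apply: leq_trans le1 _; rewrite leq_add2l.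
Qed.

Lemma neg_index_nonneg n r (H : 'M[C]_n) (M : 'M[C]_(n, r)) : H^t* = H ->
  (forall v : 'rV_n, v *m M = 0 -> 0 <= qform H v v) ->
  (neg_index H <= r)%N.
Proof.
move=> hH Hp; have [U Un <-] := exists_negdef hH.
have /(negdef_nonneg_rank Un) : forall v, (v <= kermx M)%MS -> 0 <= qform H v v.
  by move=> v /sub_kermxP; apply: Hp.
rewrite mxrank_ker; have := rank_leq_row M; have := rank_leq_col M.
by move: (\rank M) (\rank U) => a b; clear; lia.
Qed.

Lemma qformDl n (H1 H2 : 'M[C]_n) u v :
  qform (H1 + H2) u v = qform H1 u v + qform H2 u v.
Proof. by rewrite /qform mulmxDr mulmxDl mxE. Qed.

(** Both forms are nonnegative on an intersection of codimension at most the sum of the two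
    indices. *)
Lemma neg_index_add n (H1 H2 : 'M[C]_n) : H1^t* = H1 -> H2^t* = H2 ->
  (neg_index (H1 + H2) <= neg_index H1 + neg_index H2)%N.
Proof.
move=> h1 h2.
have h12 : (H1 + H2)^t* = H1 + H2 by rewrite raddfD /= map_mxD h1 h2.
have [U Un <-] := exists_negdef h12.
have [m1 [N1 p1 r1]] := exists_nonneg h1.
have [m2 [N2 p2 r2]] := exists_nonneg h2.
have : (\rank U + \rank (N1 :&: N2)%MS <= n)%N.
  apply: negdef_nonneg_rank Un _ => v; rewrite sub_capmx => /andP[v1 v2].
  by rewrite qformDl addr_ge0 ?p1 ?p2.
have := mxrank_sum_cap N1 N2; have := rank_leq_col (N1 + N2)%MS.
move: (\rank U) (\rank (N1 + N2)%MS) (\rank (N1 :&: N2)%MS) r1 r2.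
move: (\rank N1) (\rank N2) (neg_index H1) (neg_index H2) => a b k l u s i *.
lia.
Qed.

Lemma neg_index0 n : neg_index (0 : 'M[C]_n) = 0%N.
Proof.
apply/eqP; rewrite -leqn0; apply: (@neg_index_nonneg _ _ _ (0 : 'M_(n, 0))).
  by rewrite trmx0 map_mx0.
by move=> v _; rewrite /qform mulmx0 mul0mx mxE.
Qed.

Lemma qform_conj n (H : 'M[C]_n) u v : H^t* = H -> qform H v u = (qform H u v)^*.
Proof.
move=> hH; rewrite /qform.
have <- : (u *m H *m v^t*)^t* = v *m H *m u^t*.
  by rewrite !trmx_mul !map_mxM trmxCK hH mulmxA.
by rewrite !mxE.
Qed.

Lemma qformDvl n (H : 'M[C]_n) u1 u2 v :
  qform H (u1 + u2) v = qform H u1 v + qform H u2 v.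
Proof. by rewrite /qform !mulmxDl mxE. Qed.

Lemma qformDvr n (H : 'M[C]_n) u v1 v2 :
  qform H u (v1 + v2) = qform H u v1 + qform H u v2.
Proof. by rewrite /qform raddfD /= map_mxD mulmxDr mxE. Qed.

Lemma qformZl n (H : 'M[C]_n) a u v : qform H (a *: u) v = a * qform H u v.
Proof. by rewrite /qform -!scalemxAl mxE. Qed.

Lemma qformZr n (H : 'M[C]_n) a u v : qform H u (a *: v) = a^* * qform H u v.
Proof. by rewrite /qform linearZ /= map_mxZ -scalemxAr mxE. Qed.

Lemma negdef_addsmx n m1 m2 (H : 'M[C]_n) (U1 : 'M[C]_(m1, n)) (U2 : 'M[C]_(m2, n)) :
  H^t* = H -> negdef H U1 -> negdef H U2 ->
  (forall w1 w2 : 'rV_n, (w1 <= U1)%MS -> (w2 <= U2)%MS -> qform H w1 w2 = 0) ->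
  negdef H (U1 + U2)%MS /\ \rank (U1 + U2)%MS = (\rank U1 + \rank U2)%N.
Proof.
move=> hH n1 n2 o12.
have qD w1 w2 : (w1 <= U1)%MS -> (w2 <= U2)%MS ->
    qform H (w1 + w2) (w1 + w2) = qform H w1 w1 + qform H w2 w2.
  move=> w1U w2U; have := o12 _ _ w1U w2U; have := qform_conj w1 w2 hH.
  by move=> + o; rewrite qformDvl !qformDvr o conjC0 => ->; rewrite addr0 add0r.
have le0 m (U : 'M_(m, n)) v : negdef H U -> (v <= U)%MS -> qform H v v <= 0.
  move=> nU vU; have [->|/nU-/(_ vU)/ltW//] := eqVneq v 0.
  by rewrite /qform !mul0mx mxE.
split.
  move=> v /sub_addsmxP[[/= a b] ->].
  have aU : (a *m U1 <= U1)%MS by apply: submxMl.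
  have bU : (b *m U2 <= U2)%MS by apply: submxMl.
  rewrite qD //; have [->|a0 _] := eqVneq (a *m U1) 0.
    by rewrite add0r {1}/qform !mul0mx mxE add0r; apply: n2.
  by rewrite -[ltRHS]addr0 ltr_leD ?n1 ?(le0 _ _ _ n2).
rewrite -mxrank_sum_cap; suff -> : (U1 :&: U2)%MS = 0 by rewrite mxrank0 addn0.
apply/eqP; apply: contraT => /rowV0Pn[v]; rewrite sub_capmx => /andP[v1 v2] v0.
by have := n1 v v1 v0; rewrite o12 // ltxx.
Qed.

Lemma neg_index_orthogonal n (H Q1 Q2 : 'M[C]_n) : H^t* = H ->
  Q1 *m H *m Q2^t* = 0 ->
  (neg_index (Q1 *m H *m Q1^t*) + neg_index (Q2 *m H *m Q2^t*) <= neg_index H)%N.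
Proof.
move=> hH Q12.
have [U1 n1 <-] := exists_negdef (hermitian_congr Q1 hH).
have [U2 n2 <-] := exists_negdef (hermitian_congr Q2 hH).
have [m1 <-] := negdef_congr n1; have [m2 <-] := negdef_congr n2.
have [|m12 <-] := negdef_addsmx hH m1 m2; last exact: negdef_rank.
move=> w1 w2 /submxP[a ->] /submxP[b ->]; rewrite /qform !trmx_mul !map_mxM !mulmxA.
by rewrite -[_ *m Q1 *m H]mulmxA -[_ *m (Q1 *m H) *m _]mulmxA Q12 mulmx0 !mul0mx mxE.
Qed.

(** A negative definite subspace in the image of [Q] gains one dimension from a negative vector
    orthogonal to that image. *)
Lemma neg_index_vector n (H Q : 'M[C]_n) (y : 'rV[C]_n) : H^t* = H ->
  Q *m H *m y^t* = 0 -> qform H y y < 0 ->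
  (neg_index (Q *m H *m Q^t*) < neg_index H)%N.
Proof.
move=> hH Qy y0.
have [U1 n1 <-] := exists_negdef (hermitian_congr Q hH).
have [m1 <-] := negdef_congr n1.
have yn0 : y != 0 by apply: contraTneq y0 => ->; rewrite /qform !mul0mx mxE ltxx.
have n2 : negdef H y.
  move=> v /sub_rVP[a ->]; rewrite scaler_eq0 (negPf yn0) orbF => a0.
  rewrite qformZl qformZr mulrA -normCK.
  by rewrite pmulr_rlt0 // exprn_gt0 // normr_gt0.
have [|m12] := negdef_addsmx hH m1 n2.
  move=> w1 w2 /submxP[a ->] /sub_rVP[b ->]; rewrite qformZr /qform.
  rewrite !mulmxA -[_ *m Q *m H]mulmxA -[_ *m (Q *m H) *m _]mulmxA Qy.
  by rewrite mulmx0 mxE mulr0.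
by rewrite rank_rV yn0 addn1 => <-; apply: negdef_rank.
Qed.

(** * Principal submatrices and deletions *)

Definition coord_proj n (P : pred 'I_n) : 'M[C]_n := diag_mx (\row_i (P i)%:R).

(** A principal submatrix padded with zeros to its original size; the padding only contributes zero
    eigenvalues. *)
Definition restrict n (P : pred 'I_n) (H : 'M[C]_n) : 'M[C]_n :=
  coord_proj P *m H *m coord_proj P.

Lemma coord_projE n (P : pred 'I_n) m (M : 'M[C]_(n, m)) i j :
  (coord_proj P *m M) i j = (P i)%:R * M i j.
Proof. by rewrite mul_diag_mx !mxE. Qed.

Lemma restrictE n (P : pred 'I_n) (H : 'M[C]_n) i j :
  restrict P H i j = (P i && P j)%:R * H i j.
Proof.
by rewrite /restrict mul_mx_diag [LHS]mxE coord_projE mxE -mulnb natrM mulrAC.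
Qed.

Lemma coord_projC n (P : pred 'I_n) : (coord_proj P)^t* = coord_proj P.
Proof.
by rewrite tr_diag_mx map_diag_mx; congr diag_mx; apply/rowP => i; rewrite !mxE rmorph_nat.
Qed.

Lemma restrict_hermitian n (P : pred 'I_n) (H : 'M[C]_n) :
  H^t* = H -> (restrict P H)^t* = restrict P H.
Proof.
by move=> hH; rewrite /restrict !trmx_mul !map_mxM !coord_projC hH mulmxA.
Qed.

Lemma hermitian_entryC n (H : 'M[C]_n) i j : H^t* = H -> (H i j)^* = H j i.
Proof. by move=> hH; rewrite -[in RHS]hH !mxE. Qed.

Lemma restrictI n (P Q : pred 'I_n) (H : 'M[C]_n) : {subset P <= Q} ->
  restrict P (restrict Q H) = restrict P H.
Proof.
move=> PQ; apply/matrixP => i j; rewrite !restrictE mulrA -natrM mulnb.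
congr (_%:R * _); congr (nat_of_bool _); apply/andP/idP => [[]//|].
by move=> /[dup] /andP[/PQ Qi /PQ Qj] ->; rewrite -!topredE /= in Qi Qj; rewrite Qi Qj.
Qed.

Lemma neg_index_restrict n (P : pred 'I_n) (H : 'M[C]_n) : H^t* = H ->
  (neg_index (restrict P H) <= neg_index H)%N.
Proof. by move=> hH; rewrite /restrict -{2}coord_projC; apply: neg_index_congr. Qed.

Lemma qform_sum n (H : 'M[C]_n) u v :
  qform H u v = \sum_i \sum_j u 0 i * H i j * (v 0 j)^*.
Proof.
rewrite /qform mxE exchange_big /=; apply: eq_bigr => j _.
by rewrite !mxE big_distrl /=; apply: eq_bigr => i _.
Qed.

Lemma neg_index_delete n (H1 H2 : 'M[C]_n) (A : {set 'I_n}) :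
  H1^t* = H1 -> H2^t* = H2 ->
  (forall i j, i \notin A -> j \notin A -> H1 i j = H2 i j) ->
  (neg_index H1 <= #|A| + neg_index H2)%N.
Proof.
move=> h1 h2 H12.
apply: (@neg_index_ker _ _ _ _ (\matrix_(i, k) (i == enum_val k)%:R)) => // v vM.
have v0 a : a \in A -> v 0 a = 0.
  move=> aA; move/rowP: vM => /(_ (enum_rank_in aA a)); rewrite !mxE.
  rewrite (bigD1 a) //= mxE enum_rankK_in // eqxx mulr1 big1 ?addr0 //.
  by move=> i ia; rewrite mxE enum_rankK_in // (negPf ia) mulr0.
rewrite !qform_sum; apply: eq_bigr => i _; apply: eq_bigr => j _.
have [/v0 ->|iA] := boolP (i \in A); first by rewrite !mul0r.
have [/v0 ->|jA] := boolP (j \in A); first by rewrite conjC0 !mulr0.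
by rewrite H12.
Qed.

(* Subtracting multiples of the row and column of [v], whose only nonzero entry is at [u],
   clears those of [u] up to a hyperbolic plane. *)
Lemma neg_index_pendant n (H : 'M[C]_n) (u v : 'I_n) : H^t* = H ->
  H u u = 0 -> H v u != 0 -> (forall j, j != u -> H v j = 0) ->
  (neg_index (restrict (fun i => (i != u) && (i != v)) H) < neg_index H)%N.
Proof.
move=> hH Huu Hvu Hv.
have vu : v != u by apply: contraNneq Hvu => ->; rewrite Huu.
have HC i j := hermitian_entryC i j hH.
have Hiv i : i != u -> H i v = 0 by move=> iu; rewrite -HC Hv // conjC0.
set P := (fun i => _).
pose a : 'cV_n := \col_i (H i u / H v u).
pose Q := coord_proj P *m (1%:M - a *m delta_mx (0 : 'I_1) v).
have QH i k : (Q *m H) i k = (P i)%:R * (if k == u then 0 else H i k).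
  rewrite -mulmxA coord_projE; congr (_ * _).
  rewrite mulmxBl mul1mx -mulmxA -rowE !mxE big_ord1 !mxE.
  have [->|ku] := eqVneq k u; first by rewrite divfK // subrr.
  by rewrite (Hv k ku) mulr0 subr0.
have QHv i : (Q *m H) i v = 0.
  rewrite QH (negPf vu) /P; have [->|iu] := eqVneq i u; first by rewrite mul0r.
  by rewrite (Hiv _ iu) mulr0.
have QHQ : Q *m H *m (1%:M - a *m delta_mx (0 : 'I_1) v)^t* = Q *m H.
  rewrite raddfB /= map_mxB trmx1 map_mx1 mulmxBr mulmx1 trmx_mul map_mxM mulmxA.
  rewrite trmx_delta map_delta_mx -colE.
  suff -> : col v (Q *m H) = 0 by rewrite mul0mx subr0.
  by apply/colP => i; rewrite mxE QHv mxE.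
have -> : restrict P H = Q *m H *m Q^t*.
  apply/matrixP => i j; rewrite restrictE.
  rewrite [in Q^t*]/Q trmx_mul map_mxM coord_projC mulmxA QHQ mul_mx_diag.
  rewrite [RHS]mxE QH mxE -mulnb natrM /P.
  have [->|ju] := eqVneq j u; first by rewrite /= !mulr0 mul0r.
  by rewrite mulrAC.
(* The diagonal entries at [u] and [v] vanish, so the form at this vector is -2 |H u v|^2. *)
pose y : 'rV[C]_n := delta_mx 0 u - H u v *: delta_mx 0 v.
have yC : y^t* = delta_mx u 0 - H v u *: delta_mx v 0.
  by rewrite raddfB /= map_mxB linearZ /= map_mxZ !trmx_delta !map_delta_mx -[in RHS]HC.
apply: (@neg_index_vector _ _ _ y) => //.
  rewrite yC mulmxBr -scalemxAr -!colE.
  have -> : col v (Q *m H) = 0 by apply/colP => i; rewrite mxE QHv mxE.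
  by rewrite scaler0 subr0; apply/colP => i; rewrite mxE QH eqxx mulr0 mxE.
have Hvv : H v v = 0 by apply: Hv.
rewrite /qform yC mulmxBr -scalemxAr -!colE mulmxBl -scalemxAl -!rowE !mxE.
rewrite Huu Hvv mulr0 subr0 sub0r -opprD oppr_lt0 -HC [_^* * _]mulrC -normCK.
by rewrite addr_gt0 // exprn_gt0 // normr_gt0.
Qed.
End NegativeInertia.

(** * Negative inertia of mixed graphs *)

Section MixedGraphInertia.
Variables (C : numClosedFieldType) (V : finType) (G : mixed_graph V).
Implicit Types (S T A : {set V}) (x y z : V).
Local Open Scope ring_scope.
Local Open Scope sesquilinear_scope.

Local Notation h := (hermitian_entry G C).
Local Notation H := (hermitian_adjacency G C).

Lemma hermitian_entry_conj x y : (h x y)^* = h y x.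
Proof.
rewrite /hermitian_entry; have [xy|xy] := boolP (arc G x y).
  by rewrite (negPf (arc_asym xy)) conjCi.
have [yx|yx] := boolP (arc G y x); first by rewrite rmorphN /= conjCi opprK.
by rewrite adj_sym; case: ifP; rewrite ?conjC1 ?conjC0.
Qed.

Lemma hermitian_entry_eq0 x y : ~~ adj G x y -> h x y = 0.
Proof.
move=> xy; rewrite /hermitian_entry (negPf xy) !ifN //.
  by apply: contra xy => /arc_adj; rewrite adj_sym.
by apply: contra xy => /arc_adj.
Qed.

Lemma hermitian_entry_mulC x y : adj G x y -> h x y * h y x = 1.
Proof.
move=> xy; have yx : adj G y x by rewrite adj_sym.
rewrite /hermitian_entry xy yx.
have [a|a] := boolP (arc G x y).
  by rewrite (negPf (arc_asym a)) mulrN -expr2 sqrCi opprK.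
have [b|b] := boolP (arc G y x); first by rewrite mulNr -expr2 sqrCi opprK.
by rewrite mulr1.
Qed.

Lemma hermitian_entry_neq0 x y : adj G x y -> h x y != 0.
Proof.
move=> /hermitian_entry_mulC; apply: contra_eq_neq => ->.
by rewrite mul0r eq_sym oner_eq0.
Qed.

Lemma hermitian_adjacencyC : H^t* = H.
Proof. by apply/matrixP => i j; rewrite !mxE hermitian_entry_conj. Qed.

Definition sub_hermitian S : 'M[C]_#|V| := restrict (fun i => enum_val i \in S) H.

Definition neg_inertia S : nat := neg_index (sub_hermitian S).

Lemma sub_hermitianE S x y : sub_hermitian S (enum_rank x) (enum_rank y) =
  if (x \in S) && (y \in S) then h x y else 0.
Proof.
by rewrite /sub_hermitian restrictE !mxE !enum_rankK; case: ifP; rewrite ?mul1r ?mul0r.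
Qed.

Lemma sub_hermitianC S : (sub_hermitian S)^t* = sub_hermitian S.
Proof. exact/restrict_hermitian/hermitian_adjacencyC. Qed.

Lemma eq_matrix_rank (M N : 'M[C]_#|V|) :
  (forall x y, M (enum_rank x) (enum_rank y) = N (enum_rank x) (enum_rank y)) -> M = N.
Proof.
by move=> E; apply/matrixP => i j; rewrite -(enum_valK i) -(enum_valK j) E.
Qed.

Lemma sub_hermitian_setT : sub_hermitian setT = H.
Proof.
by apply: eq_matrix_rank => x y; rewrite sub_hermitianE !inE !mxE !enum_rankK.
Qed.

Lemma neg_inertia_setT : neg_inertia setT = num_neg_eigenvalues C G.
Proof. by rewrite /neg_inertia sub_hermitian_setT. Qed.

Lemma restrict_sub_hermitian S T : S \subset T ->
  restrict (fun i => enum_val i \in S) (sub_hermitian T) = sub_hermitian S.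
Proof. by move=> /subsetP ST; apply: restrictI => i; rewrite -!topredE /=; apply: ST. Qed.

Lemma neg_inertiaS S T : S \subset T -> (neg_inertia S <= neg_inertia T)%N.
Proof.
by move=> ST;
  rewrite /neg_inertia -(restrict_sub_hermitian ST) neg_index_restrict // sub_hermitianC.
Qed.

Lemma neg_inertia_delete S A : (neg_inertia S <= #|A| + neg_inertia (S :\: A))%N.
Proof.
rewrite -(card_imset A enum_rank_inj); apply: neg_index_delete; rewrite ?sub_hermitianC // => i j.
rewrite -(enum_valK i) -(enum_valK j) !(mem_imset _ _ enum_rank_inj) => iA jA.
by rewrite !sub_hermitianE !inE iA jA.
Qed.

Lemma neg_inertia_independent S : {in S &, forall x y, ~~ adj G x y} -> neg_inertia S = 0%N.
Proof.
move=> ind; rewrite /neg_inertia; suff -> : sub_hermitian S = 0 by apply: neg_index0.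
apply: eq_matrix_rank => x y; rewrite sub_hermitianE [RHS]mxE.
by case: ifP => // /andP[xS yS]; rewrite hermitian_entry_eq0 ?ind.
Qed.

Lemma neg_inertia_cover S A : vertex_cover G S A -> (neg_inertia S <= #|A|)%N.
Proof.
move=> /vertex_coverP cA; apply: leq_trans (neg_inertia_delete S A) _.
rewrite neg_inertia_independent ?addn0 // => x y /setDP[xS xA] /setDP[yS yA].
by apply/negP => /(cA _ _ xS yS); rewrite (negPf xA) (negPf yA).
Qed.

Lemma neg_inertia_pendant S u v : u \in S -> v \in S -> adj G v u ->
  {in S, forall x, adj G v x -> x = u} ->
  (neg_inertia (S :\ u :\ v) < neg_inertia S)%N.
Proof.
move=> uS vS vu vN; rewrite /neg_inertia.
have E : sub_hermitian (S :\ u :\ v) =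
    restrict (fun i => (i != enum_rank u) && (i != enum_rank v)) (sub_hermitian S).
  rewrite -(@restrict_sub_hermitian _ S); last first.
    by apply/subsetP => t; rewrite !in_setD1 => /and3P[].
  apply: eq_matrix_rank => x y; rewrite [LHS]restrictE [RHS]restrictE sub_hermitianE.
  rewrite !(inj_eq enum_rank_inj) !enum_rankK !in_setD1.
  have [xS|_] := boolP (x \in S); last by rewrite !mulr0.
  have [yS|_] := boolP (y \in S); last by rewrite !mulr0.
  by rewrite !andbT ![(_ != v) && _]andbC.
have uu : sub_hermitian S (enum_rank u) (enum_rank u) = 0.
  by rewrite sub_hermitianE hermitian_entry_eq0 ?adj_irr // if_same.
have vu0 : sub_hermitian S (enum_rank v) (enum_rank u) != 0.
  by rewrite sub_hermitianE vS uS hermitian_entry_neq0.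
rewrite E; apply: neg_index_pendant => //; first exact: sub_hermitianC.
move=> j; rewrite -(enum_valK j) (inj_eq enum_rank_inj) sub_hermitianE => ju.
case: ifP => // /andP[_ jS]; rewrite hermitian_entry_eq0 //.
by apply: contra ju => /(vN _ jS) ->.
Qed.

(** Subadditivity of the index gives one inequality, orthogonality of the two coordinate subspaces
    the other. *)
Lemma neg_inertiaU S T : [disjoint S & T] -> {in S & T, forall x y, ~~ adj G x y} ->
  neg_inertia (S :|: T) = (neg_inertia S + neg_inertia T)%N.
Proof.
move=> dST nST; apply/eqP; rewrite eqn_leq; apply/andP; split.
  rewrite /neg_inertia.
  have -> : sub_hermitian (S :|: T) = sub_hermitian S + sub_hermitian T.
    apply: eq_matrix_rank => x y; rewrite [RHS]mxE !sub_hermitianE !in_setU.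
    have [xS|xS] := boolP (x \in S); have [yS|yS] := boolP (y \in S).
    - by rewrite (disjointFr dST xS) addr0.
    - rewrite (disjointFr dST xS) addr0 /=; case: ifP => // yT.
      by rewrite hermitian_entry_eq0 // nST.
    - rewrite (disjointFr dST yS) andbF addr0 /= andbT; case: ifP => // xT.
      by rewrite hermitian_entry_eq0 // adj_sym nST.
    - by rewrite add0r.
  by apply: neg_index_add; apply: sub_hermitianC.
pose Q (U : {set V}) : 'M[C]_#|V| := coord_proj C (fun i => enum_val i \in U).
have QE (U : {set V}) : U \subset S :|: T ->
    sub_hermitian U = Q U *m sub_hermitian (S :|: T) *m (Q U)^t*.
  by move=> UST; rewrite /Q coord_projC -(restrict_sub_hermitian UST).
rewrite {1}/neg_inertia (QE _ (subsetUl S T)) /neg_inertia (QE _ (subsetUr S T)).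
apply: neg_index_orthogonal; first exact: sub_hermitianC.
apply/matrixP => i j; rewrite [RHS]mxE.
rewrite /Q coord_projC mul_mx_diag [LHS]mxE coord_projE [(\row__ _) _ _]mxE.
rewrite -(enum_valK i) -(enum_valK j) sub_hermitianE !enum_rankK !in_setU.
have [xS|xS] := boolP (enum_val i \in S); last by rewrite !mul0r.
have [yT|yT] := boolP (enum_val j \in T); last by rewrite mulr0.
by rewrite orbT hermitian_entry_eq0 ?mulr0 ?mul0r // nST.
Qed.

Lemma neg_inertia_acyclic S : cycle_rank G S = 0%N ->
  (2 * neg_inertia S <= max_matched G S)%N.
Proof.
move=> /koenig_forest[A [f [_ /neg_inertia_cover le fm fA]]].
by apply: leq_trans (max_matchedP fm); rewrite fA leq_mul2l.
Qed.

Lemma neg_inertia_delete1 S x : x \in S -> (neg_inertia S <= (neg_inertia (S :\ x)).+1)%N.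
Proof.
by move=> xS; apply: leq_trans (neg_inertia_delete S [set x]) _; rewrite cards1.
Qed.

Lemma neg_inertia_le S : (2 * neg_inertia S <= max_matched G S + 2 * cycle_rank G S)%N.
Proof.
have [n] := ubnP #|S|; elim: n S => // n IH S le.
have [E|/cycle_rank_gt0[x xS ex]] := posnP (cycle_rank G S).
  by rewrite E addn0; apply: neg_inertia_acyclic.
have l1 := neg_inertia_delete1 xS.
have l2 : (2 * neg_inertia (S :\ x) <= max_matched G (S :\ x) + 2 * cycle_rank G (S :\ x))%N.
  by apply: IH; move: le; rewrite [#|S|](cardsD1 x) xS.
have l3 := max_matchedS G (subsetDl S [set x]).
have l4 := cycle_rank_delete G xS.
move: l1 l2 l3 l4 ex; move: (neg_inertia _) (neg_inertia _) (max_matched _ _) (max_matched _ _).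
move: (cycle_rank _ _) (cycle_rank _ _) (excess _ _ _) => a b e n1 n2 m1 m2.
by clear; lia.
Qed.

(** * Reduction to the individual cycles *)

Section DisjointCycles.
Hypothesis dj : disjoint_cycles G.
Local Close Scope ring_scope.

Lemma cover_cycle_not_adj A K K' x y : A \subset noncyclic G -> cycle_cover G A ->
  K \in cycle_sets G -> K' \in cycle_sets G -> K != K' -> x \in K -> y \in K' -> ~~ adj G x y.
Proof.
move=> AW cA KK KK' ne xK yK'.
have nA K1 z : K1 \in cycle_sets G -> z \in K1 -> z \notin A.
  move=> K1K zK; apply/negP => /(subsetP AW); rewrite inE => /negP; apply.
  by apply/bigcupP; exists K1.
apply/negP => /cA[xA|yA|[K2 [KK2 xK2 yK2]]].
- by have := nA _ _ KK xK; rewrite xA.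
- by have := nA _ _ KK' yK'; rewrite yA.
case/eqP: ne; rewrite (cycle_set_uniq dj KK KK2 xK xK2).
exact: (cycle_set_uniq dj KK2 KK' yK2 yK').
Qed.

Lemma neg_inertia_cycles A (D : {set {set V}}) : A \subset noncyclic G -> cycle_cover G A ->
  D \subset cycle_sets G -> neg_inertia (cover D) = \sum_(K in D) neg_inertia K.
Proof.
move=> AW cA; have [n] := ubnP #|D|; elim: n D => // n IH D le DK.
have [->|[K KD]] := set_0Vmem D.
  rewrite big_set0 /cover big_set0; apply: neg_inertia_independent => x y.
  by rewrite inE.
have DK' : D :\ K \subset cycle_sets G by apply: subset_trans DK; apply: subsetDl.
rewrite (big_setD1 K) //= -IH //; last by move: le; rewrite [#|D|](cardsD1 K) KD.
rewrite [cover D](big_setD1 K) //=; apply: neg_inertiaU.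
  apply/pred0P => x /=; apply/negP => /andP[xK /bigcupP[K' /setD1P[ne K'D] xK']].
  by case/eqP: ne; apply: (cycle_set_uniq dj _ _ xK' xK); apply: (subsetP DK).
move=> x y xK /bigcupP[K' /setD1P[ne K'D] yK'].
apply: (cover_cycle_not_adj AW cA (subsetP DK K KD) (subsetP DK K' K'D)) => //.
by rewrite eq_sym.
Qed.

(** After deletion of [A] the only edges left lie inside cycles, and the remaining vertices off the
    cycles contribute zero rows. *)
Lemma neg_inertia_cycle_cover A : A \subset noncyclic G -> cycle_cover G A ->
  neg_inertia setT <= #|A| + neg_inertia (cover (cycle_sets G)).
Proof.
move=> AW cA; apply: leq_trans (neg_inertia_delete _ A) _; rewrite leq_add2l.
rewrite /neg_inertia.
suff -> : sub_hermitian (setT :\: A) = sub_hermitian (cover (cycle_sets G)) by [].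
apply: eq_matrix_rank => x y; rewrite !sub_hermitianE !in_setD !in_setT !andbT.
have ZA z : z \in cover (cycle_sets G) -> z \notin A.
  by apply: contraL => /(subsetP AW); rewrite inE.
have [xy|xy] := boolP (adj G x y); last by rewrite hermitian_entry_eq0 // !if_same.
congr (if _ then _ else _); apply/andP/andP => [[xA yA]|[/ZA -> /ZA ->]] //.
case: (cA _ _ xy) => [|| [K [KK xK yK]]]; rewrite ?(negPf xA) ?(negPf yA) //.
by split; apply/bigcupP; exists K.
Qed.

Lemma noncyclic_acyclic S : S \subset noncyclic G -> cycle_rank G S = 0.
Proof.
move=> SW; rewrite cycle_rank_cycles //; apply/eqP; rewrite cards_eq0.
apply/eqP/setP => K; rewrite in_set0 inE; apply/negP => /andP[KK /subsetP KS].
have /cycle_setsP[[|x c] // cc KE] := KK.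
have xK : x \in K by rewrite KE inE mem_head.
have := subsetP SW x (KS x xK); rewrite inE => /negP; apply.
by apply/bigcupP; exists K.
Qed.

Lemma card_nbrs S x : #|nbrs G S x| = \sum_(y in S) adj G x y.
Proof.
rewrite -sum1_card big_mkcond [RHS]big_mkcond /=; apply: eq_bigr => y _.
by rewrite inE; case: (y \in S) => //=; case: adj.
Qed.

(* Counting edges in the forest induced on [A :|: g @: A], some matched vertex outside
   the cover has its partner as only neighbour, so pendant pairs can be removed one by one. *)
Lemma neg_inertia_matched_cover A g : A \subset noncyclic G -> cycle_cover G A ->
  matching_fun G (noncyclic G) g -> #|matched_set g| = 2 * #|A| ->
  #|A| + neg_inertia (cover (cycle_sets G)) <= neg_inertia setT.
Proof.
move=> AW cA gm gE; have /matching_funP[gg gS] := gm.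
set Z := cover (cycle_sets G).
have suppE : matched_set g \subset A :|: g @: A.
  apply/subsetP => x; rewrite inE => gx; have [xW xgx] := gS x gx.
  rewrite in_setU; case: (cA _ _ xgx) => [->//|gxA|[K [KK xK _]]].
    by apply/orP; right; rewrite -(gg x); apply: imset_f.
  by move: xW; rewrite inE => /negP[]; apply/bigcupP; exists K.
have cardg (A' : {set V}) : #|g @: A'| = #|A'| by apply/card_imset/can_inj/gg.
have /eqP dAg : A :&: g @: A == set0.
  have := subset_leq_card suppE; rewrite gE -cards_eq0 cardsU cardg.
  have := subset_leq_card (subsetIl A (g @: A)); clear; lia.
have gA a : a \in A -> g a \notin A.
  move=> aA; apply/negP => gaA; have : g a \in A :&: g @: A by rewrite inE gaA imset_f.
  by rewrite dAg inE.
have ga a : a \in A -> g a != a by move=> aA; apply: contraNneq (gA a aA) => ->.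
have gW a : a \in A -> g a \in noncyclic G.
  by move=> /ga ne; have [] := gS (g a); rewrite // gg eq_sym.
have nadj b x : b \in noncyclic G -> b \notin A -> adj G b x -> x \in A.
  move=> bW bA /cA[|//|[K [KK bK _]]]; first by rewrite (negPf bA).
  by move: bW; rewrite inE => /negP[]; apply/bigcupP; exists K.
suff step n (A' : {set V}) : #|A'| = n -> A' \subset A ->
    n + neg_inertia Z <= neg_inertia (A' :|: g @: A' :|: Z).
  by apply: leq_trans (step _ A erefl (subxx _)) _; apply/neg_inertiaS/subsetT.
elim: n A' => [|n IH] A' cardA' A'A.
  by apply/neg_inertiaS; apply: subsetUr.
pose S' := A' :|: g @: A'.
have A'W : A' \subset noncyclic G by apply: subset_trans A'A AW.
have S'W : S' \subset noncyclic G.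
  by rewrite subUset A'W; apply/subsetP => t /imsetP[a /(subsetP A'A)/gW ? ->].
have dA' : [disjoint A' & g @: A'].
  rewrite -setI_eq0 -subset0 -dAg; apply: setISS => //; exact: imsetS.
have nb a : a \in A' -> nbrs G S' (g a) = nbrs G A' (g a).
  move=> aA'; apply/setP => t; rewrite !inE;
  have [gt|] := boolP (adj G (g a) t); rewrite ?andbF ?andbT //.
  have aA := subsetP A'A a aA'; have tA := nadj _ _ (gW a aA) (gA a aA) gt.
  have [//|tA'/=] := boolP (t \in A'); apply/negP => /imsetP[a' a'A' E].
  by have := gA a' (subsetP A'A _ a'A'); rewrite -E tA.
have [a aA' deg1] : exists2 a, a \in A' & #|nbrs G S' (g a)| <= 1.
  (* Otherwise the vertices of [g @: A'] have degrees summing to at least 2 |A'|. All these edges go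
     to [A'], which gives at least as much there, so the degree sum reaches 4 |A'|, twice the number
     of vertices: impossible in a nonempty forest. *)
  apply/exists_inP; apply: contraT => /exists_inPn deg2.
  have [a0 a0A'] : exists a0, a0 \in A' by apply/card_gt0P; rewrite cardA'.
  have comp : 0 < #|components G S'|.
    by apply/card_gt0P; exists (component G S' a0); apply: imset_f; rewrite inE a0A'.
  have cardS' : #|S'| = #|A'| + #|A'| by rewrite cardsU disjoint_setI0 // cards0 subn0 cardg.
  have dB : 2 * #|A'| <= \sum_(b in g @: A') #|nbrs G S' b|.
    rewrite -[#|A'|]cardg mulnC -sum_nat_const; apply: leq_sum => b /imsetP[a aA' ->].
    by rewrite ltnNge deg2.
  have dAB : \sum_(b in g @: A') #|nbrs G S' b| <= \sum_(a in A') #|nbrs G S' a|.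
    have -> : \sum_(b in g @: A') #|nbrs G S' b| = \sum_(b in g @: A') \sum_(a in A') adj G b a.
      by apply: eq_bigr => b /imsetP[a aA' ->]; rewrite nb // card_nbrs.
    rewrite exchange_big /=; apply: leq_sum => a aA'.
    under eq_bigr do rewrite adj_sym.
    rewrite -card_nbrs; apply/subset_leq_card/subsetP => t; rewrite !inE.
    by case/andP=> -> ->; rewrite orbT.
  have dS : degree_sum G S' = \sum_(a in A') #|nbrs G S' a| + \sum_(b in g @: A') #|nbrs G S' b|.
    rewrite /degree_sum (eq_bigl [predU A' & g @: A']) ?bigU //=.
    by move=> t; rewrite !inE.
  have := cycle_rankE G S'; rewrite noncyclic_acyclic // dS cardS'.
  move: comp dB dAB; clear; move: #|components _ _| #|A'|.
  move: (\sum_(b in g @: A') _) (\sum_(a in A') _).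
  by move=> m1 m2 m3 m4; lia.
have aA := subsetP A'A a aA'.
have aga : adj G (g a) a by rewrite adj_sym; have [] := gS a (ga a aA).
have nbE : nbrs G S' (g a) = [set a].
  apply/esym/eqP; rewrite eqEcard cards1 deg1 andbT sub1set inE aga andbT.
  by rewrite inE aA'.
pose S := S' :|: Z.
have aS : a \in S by rewrite !inE aA'.
have gaS : g a \in S by rewrite !inE imset_f ?orbT.
have := neg_inertia_pendant aS gaS aga.
have -> : S :\ a :\ g a = (A' :\ a) :|: g @: (A' :\ a) :|: Z.
  apply/setP => t; rewrite !in_setD1 !in_setU !in_setD1.
  have -> : (t \in g @: (A' :\ a)) = (t != g a) && (t \in g @: A').
    apply/imsetP/andP => [[u /setD1P[ua uA'] ->]|[tga /imsetP[u uA' E]]].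
      by rewrite (inj_eq (can_inj gg)) imset_f.
    by exists u => //; rewrite in_setD1 uA' andbT; apply: contraNneq tga => ua; rewrite E ua.
  have [->|ta] := eqVneq t a.
    rewrite (negPf (_ : a \notin g @: A')) ?andbF /=; last first.
      by apply/negP => aB; have /pred0P/(_ a) := dA'; rewrite /= aA' aB.
    by apply/esym/negbTE; have := subsetP AW a aA; rewrite inE.
  have [->|tga] := eqVneq t (g a) => //=.
  rewrite (negPf (_ : g a \notin A')) /=; last by apply: contra (gA a aA); apply: (subsetP A'A).
  by apply/esym/negbTE; have := gW a aA; rewrite inE.
move=> pend; rewrite addSn; apply: leq_ltn_trans (IH (A' :\ a) _ _) (pend _).
- by move: cardA'; rewrite (cardsD1 a) aA' => -[].
- exact: subset_trans (subsetDl _ _) A'A.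
move=> x xS gax; have xA := nadj _ _ (gW a aA) (gA a aA) gax.
apply/set1P; rewrite -nbE inE gax andbT; move: xS; rewrite in_setU => /orP[//|xZ].
by have := subsetP AW x xA; rewrite inE xZ.
Qed.

(** * The Hermitian form of an odd cycle *)

Section OddCycle.
Local Open Scope ring_scope.
Variables (x0 : V) (s : seq V).
Local Notation c := (x0 :: s).
Local Notation K := [set t in c].
Local Notation q := (size c).
Hypotheses (cc : is_cycle G c) (oddc : odd q).

Definition cycle_weight : C := \prod_(x <- c) h x (next c x).

Let p i := nth x0 c i.
Let w i := h (p i) (next c (p i)).

Let uc : uniq c. Proof. by case/and3P: cc. Qed.
Let pc i : (i < q)%N -> p i \in c. Proof. exact: mem_nth. Qed.

Let next_p i : (i < q)%N -> next c (p i) = if (i.+1 < q)%N then p i.+1 else x0.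
Proof.
move=> iq; rewrite next_nth pc // index_uniq //.
by case: ltnP => // ?; apply: nth_default.
Qed.

Let prev_p i : (i.+1 < q)%N -> prev c (p i.+1) = p i.
Proof.
by move=> iq; rewrite -[p i.+1](_ : next c (p i) = _) ?prev_next // next_p ?iq // ltnW.
Qed.

Let wwC i : (i < q)%N -> w i * (w i)^* = 1.
Proof.
move=> iq; rewrite hermitian_entry_conj hermitian_entry_mulC // next_cycle ?pc //.
by case/and3P: cc.
Qed.

(* The coordinates of the vector orthogonal to all basis vectors of the cycle but the
   first one, obtained by solving y_(i+1) = - y_(i-1) w_(i-1) w_i forwards on the even
   positions and backwards on the odd ones, starting from y_0 = y_q = 1. *)
Let yc i : C :=
  if odd i then (-1) ^+ (q - i)./2 * \prod_(i <= l < q) (w l)^*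
  else (-1) ^+ i./2 * \prod_(0 <= l < i) w l.

Let yc_rec i : (i.+1 < q)%N -> yc i * w i + yc i.+2 * (w i.+1)^* = 0.
Proof.
move=> iq; rewrite /yc /= negbK; case: ifP => [oi|_].
  have iq2 : (i.+2 <= q)%N by [].
  rewrite (big_ltn (ltnW iq)) (big_ltn iq).
  have -> : (q - i)./2 = (q - i.+2)./2.+1 by rewrite -[(q - i)%N](@subnK 2) ?addn2 ?subn2 //; lia.
  rewrite exprS mulN1r; set P := \prod_(_ <= _ < _) _.
  by have := wwC (ltnW iq); move: (w i) (w i)^* (w i.+1)^* (_ ^+ _) => a b d e E; ring: E.
rewrite !big_nat_recr //= exprS mulN1r; set P := \prod_(_ <= _ < _) _.
by have := wwC iq; move: (w i.+1) (w i.+1)^* (w i) (_ ^+ _) => a b d e E; ring: E.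
Qed.

Let yc0 : yc 0 = 1.
Proof. by rewrite /yc /= big_geq // expr0 mulr1. Qed.

(** Position q is position 0 again. As q is odd, the backward formula applies there and agrees with
    the forward one at 0. *)
Let ycq : yc q = 1.
Proof. by rewrite /yc oddc subnn big_geq // expr0 mulr1. Qed.

Let y : 'rV[C]_#|V| :=
  \row_i (if enum_val i \in c then yc (index (enum_val i) c) else 0).

Let yE x : y 0 (enum_rank x) = if x \in c then yc (index x c) else 0.
Proof. by rewrite mxE enum_rankK. Qed.

Let yp i : (i < q)%N -> y 0 (enum_rank (p i)) = yc i.
Proof. by move=> iq; rewrite yE pc // index_uniq. Qed.

Let yH x : x \in c -> (y *m sub_hermitian K) 0 (enum_rank x) =
  y 0 (enum_rank (next c x)) * h (next c x) x + y 0 (enum_rank (prev c x)) * h (prev c x) x.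
Proof.
move=> xc; rewrite mxE (reindex _ (onW_bij _ (@enum_rank_bij V))) /=.
have nc : next c x \in c by rewrite mem_next.
have pcx : prev c x \in c by rewrite mem_prev.
have [_ _ np _] := cycle_nbrs (S := K) cc (fun t tc => ltac:(by rewrite inE)) xc.
rewrite (bigD1 (next c x)) //= (bigD1 (prev c x)) 1?eq_sym //= addrA big1 ?addr0.
  by rewrite !sub_hermitianE !in_set xc nc pcx.
move=> u /andP[un up]; rewrite sub_hermitianE !in_set.
case: ifP => [/andP[uK _]|]; last by rewrite mulr0.
rewrite hermitian_entry_eq0 ?mulr0 //; apply/negP; rewrite adj_sym => xu.
by case: (disjoint_cycles_chordless dj cc xc uK xu) => E; rewrite E eqxx in un up.
Qed.

Let yH0 x : x != x0 -> (y *m sub_hermitian K) 0 (enum_rank x) = 0.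
Proof.
move=> xx0; have [xc|xc] := boolP (x \in c); last first.
  rewrite mxE big1 // => i _; rewrite -(enum_valK i) sub_hermitianE !in_set (negPf xc).
  by rewrite andbF mulr0.
have := index_mem x c; rewrite xc; case E : (index x c) => [|i] iq.
  by move: E xx0; rewrite /= eq_sym; case: eqP.
have xE : x = p i.+1 by rewrite -E /p nth_index.
rewrite yH // xE prev_p // yp 1?ltnW // -(yc_rec iq) addrC; congr (_ + _).
  by rewrite /w next_p ?iq // ltnW.
rewrite /w hermitian_entry_conj; congr (_ * _); rewrite next_p //.
case: ltnP => iq2; first by rewrite yp.
have -> : i.+2 = q by apply/eqP; rewrite eqn_leq iq.
by rewrite ycq yE mem_head /= eqxx yc0.
Qed.

Let wE : cycle_weight = \prod_(0 <= i < q) w i.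
Proof. by rewrite /cycle_weight (big_nth x0). Qed.

(* The value of the Hermitian form at that vector. *)
Definition cycle_sign : C := (-1) ^+ q./2 * (cycle_weight + cycle_weight^*).

(** Up to sign, the two neighbours of [x0] carry the products of all weights but the one on their
    edge to [x0], taken in opposite directions; these edges complete them to the weight of the cycle
    and its conjugate. *)
Let yH1 : (y *m sub_hermitian K) 0 (enum_rank x0) = cycle_sign.
Proof.
have [q1 q0] : (1 < q /\ 0 < q)%N by case/and3P: cc => /ltnW.
rewrite yH ?mem_head // prev_head //.
have n0 : next c x0 = p 1 by rewrite (next_p q0) q1.
have qE : q = q.-1.+1 by [].
have lE : last x0 s = p q.-1 by exact: (esym (nth_last x0 c)).
have nl : next c (p q.-1) = x0 by rewrite next_p // ltnn.
have /negbTE os : ~~ odd (size s) by exact: oddc.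
have kE : q./2 = (size s)./2 by rewrite /= uphalf_half os.
rewrite n0 lE !yp // /cycle_sign wE mulrDr addrC kE; congr (_ + _).
  rewrite [in RHS]qE big_nat_recr //= /yc /= os -mulrA; congr (_ * (_ * _)).
  by rewrite /w nl.
rewrite /yc /= rmorph_prod (big_ltn q0) /= subSS subn0 -mulrA; congr (_ * _).
by rewrite mulrC; congr (_ * _); rewrite /w hermitian_entry_conj n0.
Qed.

Let qform_y v : qform (sub_hermitian K) y v = cycle_sign * (v 0 (enum_rank x0))^*.
Proof.
rewrite /qform mxE (bigD1 (enum_rank x0)) //= yH1 big1 ?addr0; first by rewrite !mxE.
move=> i ix; rewrite -(enum_valK i) yH0 ?mul0r //.
by apply: contraNneq ix => <-; rewrite enum_valK.
Qed.

Let y0 : y 0 (enum_rank x0) = 1.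
Proof. by rewrite yE mem_head /= eqxx yc0. Qed.

(** The cycle rank is 1, and the number of matched vertices is even, hence at most q - 1. *)
Lemma neg_inertia_cycle_le : (2 * neg_inertia K <= q.+1)%N.
Proof.
apply: leq_trans (neg_inertia_le K) _.
have -> : cycle_rank G K = 1%N.
  rewrite cycle_rank_cycles //; apply/eqP/cards1P; exists K.
  apply/setP => K'; rewrite !inE; apply/idP/eqP.
    case/andP=> KK' sub; have KK : K \in cycle_sets G by apply/cycle_setsP; exists c.
    have /cycle_setsP[[|x c'] // cc' E] : K' \in cycle_sets G by rewrite inE.
    have xK' : x \in K' by rewrite E inE mem_head.
    apply: (cycle_set_uniq dj _ KK xK' (subsetP sub x xK')).
    by rewrite inE.
  move=> ->; rewrite subxx andbT.
  have : K \in cycle_sets G by apply/cycle_setsP; exists c.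
  by rewrite inE.
have : (max_matched G K <= q)%N.
  have [f fm <-] := max_matched_ex G K; have /matching_funP[_ fS] := fm.
  have <- : #|K| = q by rewrite cardsE; apply/card_uniqP.
  apply/subset_leq_card/subsetP => t; rewrite [t \in matched_set f]inE => ft.
  by have [] := fS t ft.
have := max_matched_even G K; move: (max_matched _ _) oddc => m; move: q => n.
by clear; lia.
Qed.

Let mem_drop_index i x : x \in c -> (x \in drop i c) = (i <= index x c)%N.
Proof.
move=> xc; have := mem_cat x (take i c) (drop i c); rewrite cat_take_drop xc in_take //.
have := uc; rewrite -{1}(cat_take_drop i c) cat_uniq => /and3P[_ /hasPn ht _].
case: ltnP => [lt _|le /esym //]; apply/negbTE/negP => /ht /negP; apply.
by rewrite in_take.
Qed.

(** On the last 2j vertices, a path missing [x0], pendant pairs are split off from the front: the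
    first vertex has only its successor as neighbour, its predecessor having been dropped. *)
Let path_inertia j : (j <= q./2)%N -> (j <= neg_inertia [set t in drop (q - j.*2) c])%N.
Proof.
elim: j => [//|j IH] jq; have qE := odd_double_half q; rewrite oddc in qE.
set i := (q - j.+1.*2)%N; have i2 : (q - j.*2 = i.+2)%N by rewrite /i; lia.
have [i1 iq] : (0 < i /\ i.+1 < q)%N by rewrite /i; split; lia.
have iq' := ltnW iq.
have D l k : (l < q)%N -> (p l \in drop k c) = (k <= l)%N.
  by move=> lq; rewrite mem_drop_index ?pc // index_uniq.
have uS : p i.+1 \in [set t in drop i c] by rewrite inE D.
have vS : p i \in [set t in drop i c] by rewrite inE D.
have ni : next c (p i) = p i.+1 by rewrite next_p ?iq.
have vu : adj G (p i) (p i.+1) by rewrite -ni next_cycle ?pc //; case/and3P: cc.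
have := neg_inertia_pendant uS vS vu; move=> pend.
apply: leq_ltn_trans (pend _).
  apply: leq_trans (IH (ltnW jq)) _; apply/neg_inertiaS/subsetP => t.
  rewrite i2 inE => td; have tc := mem_drop td.
  have it : (i.+2 <= index t c)%N by rewrite -mem_drop_index.
  rewrite in_setD1 in_setD1 inE mem_drop_index // (ltnW (ltnW it)) andbT.
  apply/andP; split; apply: contraTneq it => ->; rewrite index_uniq // -ltnNge // ltnS leqnSn.
move=> t; rewrite inE => td; have tc := mem_drop td.
move=> /(disjoint_cycles_chordless dj cc (pc iq') tc)[->//|tE].
case iE : i i1 => [//|i'] _; rewrite iE in iq' td tE.
by move: td; rewrite tE prev_p // D ?ltnn // ltnW.
Qed.

(** The path left after removing [x0] contributes q./2 dimensions, and [y] is a negative vector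
    orthogonal to its coordinates. *)
Lemma neg_inertia_cycle_gt : cycle_sign < 0 -> (q./2 < neg_inertia K)%N.
Proof.
move=> s0; have k1 := path_inertia (leqnn _).
have qE := odd_double_half q; rewrite oddc in qE.
have d1 : drop (q - q./2.*2) c = s by rewrite -{1}qE addnK drop1.
rewrite d1 in k1; apply: leq_ltn_trans k1 _; rewrite /neg_inertia.
have sK : [set t in s] \subset K by apply/subsetP => t; rewrite !inE => ->; rewrite orbT.
rewrite -(restrict_sub_hermitian sK) /restrict -{2}coord_projC.
apply: (@neg_index_vector _ _ _ _ y); first exact: sub_hermitianC.
  apply/colP => i; rewrite [RHS]mxE -mulmxA coord_projE.
  have -> : sub_hermitian K *m y^t* = (y *m sub_hermitian K)^t*.
    by rewrite trmx_mul map_mxM sub_hermitianC.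
  rewrite [_^t* _ _]mxE [_^T _ _]mxE -(enum_valK i) enum_rankK inE.
  have [E|/yH0 ->] := eqVneq (enum_val i) x0; last by rewrite conjC0 mulr0.
  by rewrite E; case/andP: uc => /negPf ->; rewrite mul0r.
by rewrite qform_y y0 conjC1 mulr1.
Qed.

(** The q./2 linear conditions say that v - v(x0) y vanishes at the positions 2, 4, ..., q - 1; at
    position 0 it vanishes anyway. On their kernel the form equals |v(x0)|^2 times [cycle_sign]. *)
Lemma neg_inertia_cycle_ge0 : 0 <= cycle_sign -> (neg_inertia K <= q./2)%N.
Proof.
move=> s0; have qE := odd_double_half q; rewrite oddc in qE.
pose e (j : 'I_(q./2)) := enum_rank (p j.+1.*2).
pose M : 'M[C]_(#|V|, q./2) :=
  \matrix_(i, j) ((i == e j)%:R - (i == enum_rank x0)%:R * y 0 (e j)).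
apply: (@neg_index_nonneg _ _ _ _ M); first exact: sub_hermitianC.
move=> v vM; pose a := v 0 (enum_rank x0); pose u := v - a *: y.
have delta (k : 'I_#|V|) (F : 'I_#|V| -> C) : \sum_i F i * (i == k)%:R = F k.
  rewrite (bigD1 k) //= eqxx mulr1 big1 ?addr0 // => i ik.
  by rewrite (negPf ik) mulr0.
have uE i : u 0 i = v 0 i - a * y 0 i by rewrite !mxE.
have u0 : u 0 (enum_rank x0) = 0 by rewrite uE y0 mulr1 subrr.
have ue i : (i < q)%N -> ~~ odd i -> u 0 (enum_rank (p i)) = 0.
  case: i => [//|i] iq oi; have iE : i.+1 = (i.+1)./2.-1.+1.*2 by lia.
  have jq : ((i.+1)./2.-1 < q./2)%N by lia.
  move/rowP: vM => /(_ (Ordinal jq)); rewrite [RHS]mxE mxE.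
  under eq_bigr do rewrite [M _ _]mxE mulrBr mulrA.
  rewrite sumrB delta -mulr_suml delta /e /= -iE => <-.
  by rewrite uE.
have vE : v = u + a *: y by rewrite /u subrK.
have yu : qform (sub_hermitian K) y u = 0 by rewrite qform_y u0 conjC0 mulr0.
have uy : qform (sub_hermitian K) u y = 0.
  by rewrite (qform_conj _ _ (sub_hermitianC K)) yu conjC0.
(* The vector [u] lives on the odd positions, which are independent: the edge closing the cycle
   joins the even positions q - 1 and 0. *)
have uu : qform (sub_hermitian K) u u = 0.
  rewrite qform_sum big1 // => i _; rewrite big1 // => j _.
  rewrite -(enum_valK i) -(enum_valK j) sub_hermitianE !in_set.
  case: ifP => [/andP[xc zc]|_]; last by rewrite mulr0 mul0r.
  move: (enum_val i) (enum_val j) xc zc => x z xc zc.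
  have pE t : t \in c -> t = p (index t c) by move=> tc; rewrite /p nth_index.
  have ut t : t \in c -> ~~ odd (index t c) -> u 0 (enum_rank t) = 0.
    by move=> tc et; rewrite {1}(pE t tc) ue // index_mem.
  have [ox|ex] := boolP (odd (index x c)); last by rewrite ut // mul0r mul0r.
  have [oz|ez] := boolP (odd (index z c)); last by rewrite [u 0 (enum_rank z)]ut // conjC0 mulr0.
  have nxt t : t \in c -> odd (index t c) -> ~~ odd (index (next c t) c).
    move=> tc ot; have tq : (index t c < q)%N by rewrite index_mem.
    rewrite {1}[t]pE // next_p //; case: ifP => [tq'|_]; first by rewrite index_uniq //= negbK.
    by rewrite /= eqxx.
  rewrite hermitian_entry_eq0 ?mulr0 ?mul0r //; apply/negP => xz.
  case: (disjoint_cycles_chordless dj cc xc zc xz) => E.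
    by have := nxt x xc ox; rewrite -E oz.
  by have := nxt z zc oz; rewrite E next_prev // ox.
clearbody u; rewrite vE qformDvl !qformDvr !qformZl !qformZr uu yu uy !mulr0 !add0r.
rewrite qform_y y0 conjC1 mulr1 mulrA -normCK mulr_ge0 // exprn_ge0 //.
Qed.

End OddCycle.

Definition odd_cycle_condition (c : seq V) : bool :=
  ~~ odd (signature G c) && (`|signature G c - size c| == 3 %[mod 4]).

(** * The sign of an odd cycle in terms of its orientation *)

Section CycleSign.
Local Open Scope ring_scope.

(** A backward arc contributes -i = i^3, whence the factor 3, which keeps the exponent a natural
    number congruent to f - b modulo 4. *)
Lemma prod_hermitian_entry (r : seq V) (f : V -> V) : (forall x, x \in r -> adj G x (f x)) ->
  \prod_(x <- r) h x (f x) =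
  'i ^+ (count (fun x => arc G x (f x)) r + 3 * count (fun x => arc G (f x) x) r).
Proof.
elim: r => [|x r IH] rf; first by rewrite big_nil.
rewrite big_cons IH => [|t tr]; last by rewrite rf // inE tr orbT.
rewrite /= mulnDr addnACA [RHS]exprD; congr (_ * _).
have xf := rf x (mem_head _ _); rewrite /hermitian_entry xf.
have [a|a] := boolP (arc G x (f x)); first by rewrite (negPf (arc_asym a)).
by case: (arc G (f x) x); rewrite // add0n muln1 -[3%N]/(2 + 1)%N exprD sqrCi mulN1r.
Qed.

(** Bounds the signature by the length, so that the absolute difference in (ii) is q minus the
    signature; the opposite sign would turn the residue 3 into 1. *)
Lemma arcs_le_size (r : seq V) (f : V -> V) :
  (count (fun x => arc G x (f x)) r + count (fun x => arc G (f x) x) r <= size r)%N.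
Proof.
elim: r => [//|x r IH] /=; rewrite addnACA -add1n leq_add //.
by have [/arc_asym/negPf ->|_] := boolP (arc G x (f x)); last case: arc.
Qed.

Lemma expCi_conj_sum e :
  'i ^+ e + ('i ^+ e)^* = if odd e then 0 else (-1) ^+ e./2 * 2 :> C.
Proof.
have even k : 'i ^+ k.*2 = (-1) ^+ k :> C by rewrite -mul2n exprM sqrCi.
have conj_sign k : ((-1) ^+ k)^* = (-1) ^+ k :> C by rewrite rmorphXn /= rmorphN1.
rewrite -{1 2}(odd_double_half e) exprD even; case: (odd e); last first.
  by rewrite expr0 mul1r conj_sign mulr_natr mulr2n.
by rewrite expr1 rmorphM /= conjCi conj_sign mulNr subrr.
Qed.

Lemma cycle_sign_cases x0 s : is_cycle G (x0 :: s) -> odd (size (x0 :: s)) ->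
  if odd_cycle_condition (x0 :: s) then cycle_sign x0 s < 0 else 0 <= cycle_sign x0 s.
Proof.
move=> cc od; have /and3P[_ uc cyc] := cc.
rewrite /cycle_sign /cycle_weight prod_hermitian_entry; last by move=> x; apply: next_cycle.
rewrite -/(forward_arcs G (x0 :: s)) -/(backward_arcs G (x0 :: s)) expCi_conj_sum.
have := arcs_le_size (x0 :: s) (next (x0 :: s)).
rewrite -/(forward_arcs G (x0 :: s)) -/(backward_arcs G (x0 :: s)).
rewrite /odd_cycle_condition /signature.
move: (forward_arcs _ _) (backward_arcs _ _) (size _) od => f b q od le.
have [oe|ee] := boolP (odd (f + 3 * b)%N).
  by rewrite mulr0 ifN //; lia.
rewrite mulrA -exprD -signr_odd.
(* An even f - b agrees modulo 4 with its absolute value and with f + 3b, so dividing the congruence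
   by 2 leaves a parity. *)
have -> : (~~ odd `|f - b|%N && (`| `|f - b|%N - q|%N == 3 %[mod 4])) =
    odd (q./2 + (f + 3 * b)./2) by lia.
by case: (odd _); rewrite ?expr1 ?expr0 ?mulN1r ?mul1r ?oppr_lt0 ?ltr0n ?ler0n.
Qed.

End CycleSign.

Lemma neg_inertia_odd_cycle c : is_cycle G c -> odd (size c) ->
  (2 * neg_inertia [set t in c] == (size c).+1) = odd_cycle_condition c.
Proof.
case: c => [//|x0 s] cc od; have := cycle_sign_cases cc od.
have le := neg_inertia_cycle_le cc od; have qE := odd_double_half (size (x0 :: s)).
rewrite od in qE;
case: ifP => [_ /(neg_inertia_cycle_gt cc od) gt|_ /(neg_inertia_cycle_ge0 cc od) ge].
  by apply/eqP; move: le qE gt; move: (neg_inertia _) (size _) => a b; clear; lia.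
by apply/negbTE; move: le qE ge; move: (neg_inertia _) (size _) => a b; clear; lia.
Qed.
End DisjointCycles.
Local Close Scope ring_scope.

Lemma card_edges : degree_sum G setT = 2 * #|edges G|.
Proof.
have -> : degree_sum G setT = \sum_x \sum_(e in edges G) (x \in e).
  rewrite /degree_sum; apply: eq_big => x; first by rewrite inE.
  move=> _; rewrite -(card_in_imset (f := fun y => [set x; y])); last first.
    move=> y z; rewrite !inE => xy _ /setP/(_ y); rewrite !inE eqxx orbT => /esym.
    by case/orP=> /eqP // yx; move: xy; rewrite yx adj_irr.
  rewrite -sum1_card big_mkcond [RHS]big_mkcond /=; apply: eq_bigr => e _.
  have -> : (e \in [set [set x; y] | y in nbrs G setT x]) = (e \in edges G) && (x \in e).
    apply/imsetP/andP => [[y]|[/imsetP[[a b]]]].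
      rewrite !inE /= => xy ->; rewrite set21; split=> //.
      by apply/imsetP; exists (x, y); rewrite // inE.
    rewrite inE /= => ab -> /set2P[] ->; [exists b | exists a]; rewrite ?inE //.
      by rewrite adj_sym.
    by rewrite setUC.
  by case: (e \in _) => //=; case: (x \in e).
rewrite exchange_big /= mulnC -sum_nat_const; apply: eq_bigr => e /imsetP[[a b]].
rewrite inE /= => ab ->.
have nab : a != b by apply: contraTneq ab => ->; rewrite adj_irr.
have := cards2 a b; rewrite nab => <-; rewrite -sum1_card [RHS]big_mkcond /=.
by apply: eq_bigr => x _; case: (x \in _).
Qed.

Lemma connected_components : connected G ->
  #|components G setT| = 1 /\ num_components G = 1.
Proof.
case=> V0 conn; have [x0 _] : exists x, x \in V by apply/card_gt0P.
have adjT : sub_adj G setT =2 adj G by move=> x y; rewrite /sub_adj !inE.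
split.
  apply/eqP/cards1P; exists (component G setT x0); apply/setP => B; rewrite inE.
  apply/imsetP/eqP => [[x _ ->]|->]; last by exists x0.
  by apply/eqP; rewrite component_eq ?inE // (eq_connect adjT).
have symG : connect_sym (adj G) by apply: sym_connect_sym; apply: adj_sym.
rewrite /num_components /n_comp_mem; apply: (@eq_card1 _ (fingraph.root (adj G) x0)) => x.
rewrite !inE andbT /=; apply/eqP/eqP => [<-|->]; last exact: root_root.
by apply/eqP; rewrite root_connect.
Qed.

Lemma cyclomaticE : connected G -> cyclomatic G = (cycle_rank G setT)%:Z%R.
Proof.
move=> /connected_components[c1 c2]; rewrite /cyclomatic c2.
have := cycle_rankE G setT; rewrite c1 card_edges cardsT.
by move: #|edges G| #|V| (cycle_rank _ _) => a b d; clear; lia.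
Qed.

(** * The case of equality *)

Definition tight S := 2 * neg_inertia S == max_matched G S + 2 * cycle_rank G S.

(** The bound for [S] follows from that for [S :\ x] with three slacks: the loss of inertia is at
    most 1, the matching does not grow, the excess is at least 1. Equality leaves no slack. *)
Lemma tight_delete S x : x \in S -> 0 < excess G S x -> tight S ->
  [/\ excess G S x = 1, max_matched G (S :\ x) = max_matched G S & tight (S :\ x)].
Proof.
move=> xS ex; rewrite /tight => /eqP.
have := neg_inertia_delete1 xS; have := neg_inertia_le (S :\ x).
have := max_matchedS G (subsetDl S [set x]); have := cycle_rank_delete G xS.
move: ex; move: (neg_inertia _) (neg_inertia _) (max_matched _ _) (max_matched _ _).
move: (cycle_rank _ _) (cycle_rank _ _) (excess _ _ _) => a b e n1 n2 m1 m2.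
by clear => *; split; first lia; first lia; apply/eqP; lia.
Qed.

(** A maximum matching of [S'] is still maximum in [S]. As [S'] contains no whole cycle, this one
    matching misses a vertex of every cycle simultaneously. *)
Lemma tight_acyclic_part S : tight S -> exists S' : {set V},
  [/\ cycle_rank G S' = 0 & max_matched G S' = max_matched G S].
Proof.
have [n] := ubnP (cycle_rank G S); elim: n S => // n IH S le tS.
have [E|/cycle_rank_gt0[x xS ex]] := posnP (cycle_rank G S); first by exists S.
have [e1 mE tS'] := tight_delete xS ex tS.
have [|S' [S'0 S'E]] := IH (S :\ x) _ tS'; last by exists S'; rewrite S'E.
by move: le; rewrite (cycle_rank_delete G xS) e1 addn1.
Qed.

Lemma tight_disjoint_cycles : tight setT -> disjoint_cycles G.
Proof.
move=> tT; apply: excess_disjoint_cycles => x.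
have [->//|ex] := posnP (excess G setT x).
by have [->] := tight_delete (in_setT x) ex tT.
Qed.

Lemma tight_matching : tight setT -> odd_cycles G /\
  exists f, [/\ matching_fun G setT f, #|matched_set f| = max_matched G setT
             & cycle_preserving G f].
Proof.
move=> tT; have dj := tight_disjoint_cycles tT.
have [S [S0 SE]] := tight_acyclic_part tT.
have [f fm fE] := max_matched_ex G S; have /matching_funP[_ fS] := fm.
have fmT := matching_funS (subsetT S) fm; rewrite SE in fE.
have iness c x : is_cycle G c -> x \in c -> max_matched G (setT :\ x) = max_matched G setT.
  move=> cc xc; have cT : {subset c <= [set: V]} by move=> t; rewrite inE.
  have [nN pN np cnp] := cycle_nbrs cc cT xc.
  have ex : 0 < excess G setT x.
    by apply/excess_gt0P; rewrite ?inE //; exists (next c x), (prev c x).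
  by have [] := tight_delete (in_setT x) ex tT.
have cyc c : is_cycle G c -> odd (size c) /\ forall x, x \in c -> f x \in c.
  move=> cc; have [p pc pS] : exists2 p, p \in c & p \notin S.
    apply/hasP; apply: contraT => /hasPn cS.
    suff : 0 < cycle_rank G S by rewrite S0.
    by apply: (cycle_rank_cycle cc) => x /cS; rewrite negbK.
  apply: (matching_missing_cycle dj iness cc fmT fE pc).
  by apply/eqP; apply: contraNT pS => /fS[].
split=> [c /cyc[]//|]; exists f; split=> // K x /cycle_setsP[c cc ->].
by rewrite !inE; have [_] := cyc c cc; apply.
Qed.

(** The contributions of [A] cancel, leaving two sums over the cycles that are comparable term by
    term; they are equal iff all their terms are. *)
Lemma tight_certificate : disjoint_cycles G -> odd_cycles G ->
  (exists f, [/\ matching_fun G setT f, #|matched_set f| = max_matched G setT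
              & cycle_preserving G f])
  \/ matching_number (contracted G) = matching_number (contracted_noncyclic G) ->
  tight setT = [forall K in cycle_sets G, 2 * neg_inertia K == #|K|.+1].
Proof.
move=> dj od H; have [A [g [AW cA gm gE mE]]] := cycle_cover_certificate dj od H.
have nE : neg_inertia setT = #|A| + \sum_(K in cycle_sets G) neg_inertia K.
  rewrite -(neg_inertia_cycles dj AW cA (subxx _)); apply/eqP.
  by rewrite eqn_leq neg_inertia_cycle_cover // (neg_inertia_matched_cover dj AW cA gm).
have cE : cycle_rank G setT = #|cycle_sets G|.
  by rewrite cycle_rank_cycles //; apply: eq_card => K; rewrite inE subsetT andbT.
have sE : \sum_(K in cycle_sets G) #|K|.+1 = \sum_(K in cycle_sets G) #|K| + #|cycle_sets G|.
  by rewrite -sum1_card -big_split /=; apply: eq_bigr => K _; rewrite addn1.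
have leK K : K \in cycle_sets G -> 2 * neg_inertia K <= #|K|.+1.
  move=> /cycle_setsP[[|x s] // cc ->]; rewrite cardsE.
  have /and3P[_ /card_uniqP -> _] := cc.
  exact: neg_inertia_cycle_le cc (od _ cc).
have -> : tight setT = (\sum_(K in cycle_sets G) 2 * neg_inertia K
    == \sum_(K in cycle_sets G) #|K|.+1).
  have := card_blocks dj; rewrite /tight nE cE sE -big_distrr /=.
  move: mE; move: (max_matched _ _) #|block G| #|V| #|A| #|cycle_sets G|.
  move: (\sum_(K in cycle_sets G) neg_inertia K) (\sum_(K in cycle_sets G) #|K|) => n k m b v a s.
  by clear => *; apply/eqP/eqP; lia.
have eqK K : K \in cycle_sets G ->
    2 * neg_inertia K <= #|K|.+1 ?= iff (2 * neg_inertia K == #|K|.+1).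
  by move=> KK; apply/leqif_eq/leK.
by have [_ ->] := leqif_sum eqK.
Qed.

Lemma neg_inertia_odd_cycles : disjoint_cycles G -> odd_cycles G ->
  [forall K in cycle_sets G, 2 * neg_inertia K == #|K|.+1] <->
  forall c, is_cycle G c -> odd_cycle_condition c.
Proof.
move=> dj od; have E c : is_cycle G c ->
    (2 * neg_inertia [set t in c] == #|[set t in c]|.+1) = odd_cycle_condition c.
  move=> cc; rewrite cardsE; have /and3P[_ /card_uniqP -> _] := cc.
  exact: (neg_inertia_odd_cycle dj cc (od c cc)).
split=> [/forall_inP H c cc|H].
  by rewrite -E //; apply: H; apply/cycle_setsP; exists c.
by apply/forall_inP => K /cycle_setsP[c cc ->]; rewrite E // H.
Qed.

End MixedGraphInertia.

Theorem theorem3p11 (C : numClosedFieldType) (V : finType)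
    (G : mixed_graph V) (Gconn : connected G) :
  ((num_neg_eigenvalues C G)%:Z = (matching_number G)%:Z + cyclomatic G)%R
  <->
  [/\ disjoint_cycles G,
      (forall c : seq V, is_cycle G c ->
         [/\ odd (size c),
             ~~ odd (signature G c) &
             `|signature G c - size c| = 3 %[mod 4]]) &
      (exists M : {set {set V}},
         is_max_matching G M /\ M :&: cycle_boundary_edges G = set0)
      \/ matching_number (contracted G)
         = matching_number (contracted_noncyclic G)].
Proof.
have -> : (((num_neg_eigenvalues C G)%:Z = (matching_number G)%:Z + cyclomatic G)%R)
    <-> tight C G setT.
  rewrite (cyclomaticE Gconn) -neg_inertia_setT /tight max_matched_number -mulnDr.
  by rewrite eqn_pmul2l //; split=> [[/eqP]//|/eqP ->].
split=> [tT|[dj cyc H]].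
  have dj := tight_disjoint_cycles tT; have [od ex] := tight_matching tT.
  split=> //; last by left; apply/cycle_preserving_matching.
  have : tight C G setT by [].
  (* With disjointness, oddness and (iii) available, the certificate turns the same equality into
     the congruence on each cycle. *)
  rewrite (tight_certificate C dj od (or_introl ex)) => /(neg_inertia_odd_cycles C dj od) H c cc.
  by have /andP[s1 /eqP s2] := H c cc; split; rewrite ?od.
have od : odd_cycles G by move=> c /cyc[].
rewrite (tight_certificate C dj od).
  by apply/(neg_inertia_odd_cycles C dj od) => c /cyc[_ s1 /eqP s2]; apply/andP.
by case: H => [/cycle_preserving_matching|]; [left | right].
Qed.
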